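(* Every finite modular planar lattice is a Shannon lattice.
   Context: A finite lattice is planar if it has a Hasse diagram drawn in the plane with no crossing edges. A lattice is modular if $a\subseteq b$ implies $a\uplus(x\cap b)=(a\uplus x)\cap b$ for all $x$ (order $\subseteq$, meet $\cap$, join $\uplus$). A polymatroid function on a finite lattice $L$ is $h:L\to\mathbb{R}$ that is non-negative, increasing and submodular ($h(x)+h(y)\ge h(x\uplus y)+h(x\cap y)$). $h$ is entropic if there exist jointly distributed discrete random variables $(X_x)_{x\in L}$ such that for all $x,y$ the variable $X_{x\uplus y}$ and the pair $(X_x,X_y)$ are functions of each other, and $h(x)=H(X_x)$ (Shannon entropy). $L$ is a Shannon lattice if the set of polymatroid functions on $L$ equals the closure in $\mathbb{R}^L$ of the set of entropic functions on $L$. *)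

(* Defs.v *)
From mathcomp Require Import all_boot all_order.
From Stdlib Require Import Reals.

Set Implicit Arguments.
Unset Strict Implicit.
Unset Printing Implicit Defensive.

Local Open Scope order_scope.

Definition modular_lattice (d : Order.disp_t) (L : latticeType d) : Prop :=
  forall a b x : L, a <= b -> a `|` (x `&` b) = (a `|` x) `&` b.

Definition covers (d : Order.disp_t) (L : porderType d) (a b : L) : Prop :=
  a < b /\ forall c : L, ~ (a < c /\ c < b).

Local Close Scope order_scope.
Local Open Scope R_scope.

Definition on_seg (P Q X : R * R) : Prop :=
  exists t : R, 0 <= t <= 1 /\
    fst X = fst P + t * (fst Q - fst P) /\
    snd X = snd P + t * (snd Q - snd P).

(** Planar lattice: its Hasse diagram has a crossing-free drawing in the plane
    (vertices = distinct points, each covering pair a < b drawn as a straight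
    segment going upward from a to b, no vertex in the interior of an edge,
    and two distinct edges meet only in a common endpoint). *)
Definition planar_lattice (d : Order.disp_t) (L : finLatticeType d) : Prop :=
  exists f : L -> R * R,
    injective f /\
    (forall a b : L, covers a b -> snd (f a) < snd (f b)) /\
    (forall a b c : L, covers a b -> c <> a -> c <> b -> ~ on_seg (f a) (f b) (f c)) /\
    (forall (a b c e : L) (X : R * R), covers a b -> covers c e -> (a, b) <> (c, e) ->
        on_seg (f a) (f b) X -> on_seg (f c) (f e) X ->
        exists z : L, X = f z /\ (z = a \/ z = b) /\ (z = c \/ z = e)).

Definition polymatroid (d : Order.disp_t) (L : finLatticeType d) (h : L -> R) : Prop :=
  (forall x, 0 <= h x) /\
  (forall x y : L, (x <= y)%O -> h x <= h y) /\
  (forall x y : L, h x + h y >= h (Order.join x y) + h (Order.meet x y)).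

(** Discrete probability: a probability mass function on a countable sample
    space (encoded by nat); discrete random variables take values in a
    countable set (encoded by nat). *)
Definition prob_dist (p : nat -> R) : Prop :=
  (forall w, 0 <= p w) /\ infinite_sum p 1.

Definition law (p : nat -> R) (X : nat -> nat) (v : nat) (q : R) : Prop :=
  infinite_sum (fun w => if Nat.eqb (X w) v then p w else 0) q.

(** Shannon entropy of X is (finite and equal to) H; convention 0 ln 0 = 0
    (Stdlib's ln is 0 at 0). *)
Definition has_entropy (p : nat -> R) (X : nat -> nat) (H : R) : Prop :=
  exists q : nat -> R, (forall v, law p X v (q v)) /\
    infinite_sum (fun v => - (q v * ln (q v))) H.

Definition entropic (d : Order.disp_t) (L : finLatticeType d) (h : L -> R) : Prop :=
  exists (p : nat -> R) (X : L -> nat -> nat),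
    prob_dist p /\
    (forall x y : L,
       (exists f : nat -> nat -> nat, forall w, 0 < p w ->
          X (Order.join x y) w = f (X x w) (X y w)) /\
       (exists g : nat -> nat * nat, forall w, 0 < p w ->
          (X x w, X y w) = g (X (Order.join x y) w))) /\
    (forall x : L, has_entropy p (X x) (h x)).

(** Closure in R^L (product = sup-norm topology, L finite). *)
Definition in_closure (d : Order.disp_t) (L : finLatticeType d) (S : (L -> R) -> Prop)
    (h : L -> R) : Prop :=
  forall eps : R, 0 < eps -> exists g : L -> R, S g /\ forall x : L, Rabs (h x - g x) < eps.

Definition shannon_lattice (d : Order.disp_t) (L : finLatticeType d) : Prop :=
  forall h : L -> R, polymatroid h <-> in_closure (@entropic d L) h.

(* Main.v *)
From HB Require Import structures.
From Stdlib Require Import Reals ZArith Lra Lia.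
Require Import Defs.
From mathcomp Require Import all_boot all_order all_algebra.
From mathcomp Require Import zify.

(** The closure of the entropic functions consists of polymatroids by the Shannon
    inequalities, which are continuous.

    Conversely, in a planar drawing of a modular lattice compare the polylines formed
    by saturated chains: two of them can only cross at a vertex.  It follows that if [a]
    has three upper covers then all its upper covers lie in an interval [a, t] of length
    two, and all but two of them ("eyes") have no other neighbours in the Hasse diagram
    than [a] and [t].  Apart from the eyes every element has at most two upper covers
    [l] and [r], so on the non-eyes a polymatroid [h] is, up to a constant, the sum over
    [a] of the functions [x |-> (x </= a)] with the weights
    [h l + h r - h a - h (l \/ r) >= 0].

    Rounding [n h] to integers, represent each non-eye [x] by the coordinates indexed by
    the [a] with [x </= a], the weight of [a] being the number of copies of its
    coordinate over a prime field.  The coordinates of [t] that are not coordinates of [a]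
    are read as the coefficients of a polynomial, and an eye is represented by the residue
    of this polynomial modulo a power of [X - c], with a different [c <> 0] for each eye;
    [l] and [r] see the top and the bottom coefficients, and the Chinese remainder theorem
    gives all the required functional dependences.  Switching the resulting uniform
    variables on with probability about [1 / n] scales the entropies back to [h]. *)

Set Implicit Arguments.
Unset Strict Implicit.
Unset Printing Implicit Defensive.

Import Order.TTheory.

(** * Planar drawings *)

Section Covers.

Variables (d : Order.disp_t) (L : finLatticeType d).
Implicit Types (a b c x y z : L) (p q : seq L).

Local Open Scope order_scope.

Definition covb a b := (a < b) && [forall c, ~~ ((a < c) && (c < b))].

Lemma covbP a b : reflect (covers a b) (covb a b).
Proof.
apply: (iffP andP) => [[ab /forallP nc]|[ab nc]]; split=> //.
  by move=> c [ac cb]; have := nc c; rewrite ac cb.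
by apply/forallP => c; apply/negP => /andP[ac cb]; apply: (nc c).
Qed.

Lemma covb_lt a b : covb a b -> a < b.
Proof. by case/andP. Qed.

Lemma covb_between a b c : covb a b -> a <= c -> c <= b -> c = a \/ c = b.
Proof.
case/andP=> _ /forallP /(_ c); rewrite !lt_neqAle => + ac cb; rewrite ac cb !andbT.
by rewrite negb_and !negbK => /orP[/eqP|/eqP]; [left|right].
Qed.

Lemma covb_uncomparable a b c : covb a b -> covb a c -> b != c -> ~~ (b <= c).
Proof.
move=> ab ac bc; apply/negP => le_bc.
case: (covb_between ac (ltW (covb_lt ab)) le_bc) => E.
  by have := covb_lt ab; rewrite E ltxx.
by rewrite E eqxx in bc.
Qed.

(** Among the elements strictly above [x] and below or equal to [y], one with the fewest elements
    below it must cover [x]. *)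
Lemma covb_above x y : x < y -> exists2 b, covb x b & b <= y.
Proof.
move=> xy; pose P b := (x < b) && (b <= y).
have Py : P y by rewrite /P xy lexx.
case: (arg_minnP (fun b => #|[set z | z <= b]|) Py) => b /andP[xb yb] bmin.
exists b => //; rewrite /covb xb /=; apply/forallP => c; apply/negP => /andP[xc cb].
have := bmin c; rewrite /P xc (le_trans (ltW cb) yb) => /(_ isT).
rewrite leqNgt => /negP[]; apply: proper_card; apply/properP; split.
  by apply/subsetP => z; rewrite !inE => /le_trans; apply; apply: ltW.
by exists b; rewrite !inE ?lexx // (lt_geF cb).
Qed.

Lemma covb_path x y : x <= y -> exists2 p, path covb x p & last x p = y.
Proof.
have [n] := ubnP #|[set z | (x <= z) && (z <= y)]|; elim: n x => // n IH x ltn xy.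
have [-> | neq] := eqVneq x y; first by exists [::].
have xy' : x < y by rewrite lt_neqAle neq.
have [b xb yb] := covb_above xy'.
have [||p pp lp] := IH b; [|exact: yb|by exists (b :: p); rewrite //= xb].
move: ltn; rewrite ltnS; apply: leq_trans; apply: proper_card; apply/properP; split.
  apply/subsetP => z; rewrite !inE => /andP[bz ->]; rewrite andbT.
  by apply: le_trans bz; apply/ltW/covb_lt.
by exists x; rewrite !inE ?lexx //= (lt_geF (covb_lt xb)).
Qed.

Lemma path_ge x p z : path covb x p -> z \in x :: p -> x <= z.
Proof.
elim: p x => [|y p IH] x /=; first by rewrite inE => _ /eqP->.
case/andP=> xy pp; rewrite inE => /predU1P[-> //|/(IH _ pp)].
by apply: le_trans; apply/ltW/covb_lt.
Qed.

Lemma path_le_last x p z : path covb x p -> z \in x :: p -> z <= last x p.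
Proof.
elim: p x z => [|y p IH] x z /=; first by rewrite inE => _ /eqP->.
case/andP=> xy pp; rewrite inE => /predU1P[->|/(IH _ _ pp) //].
by apply: (le_trans (ltW (covb_lt xy))); apply: IH => //; rewrite inE eqxx.
Qed.

End Covers.

Section Drawing.

Variables (d : Order.disp_t) (L : finLatticeType d).
Hypothesis modL : modular_lattice L.
Variable f : L -> R * R.
Hypothesis f_up : forall a b : L, covers a b -> Rlt (snd (f a)) (snd (f b)).
Hypothesis f_planar : forall (a b c e : L) (P : R * R),
  covers a b -> covers c e -> (a, b) <> (c, e) ->
  on_seg (f a) (f b) P -> on_seg (f c) (f e) P ->
  exists z : L, P = f z /\ (z = a \/ z = b) /\ (z = c \/ z = e).

Implicit Types (a b c x y z : L) (p q : seq L).

Local Open Scope R_scope.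

Local Notation X z := (fst (f z)).
Local Notation Y z := (snd (f z)).

(** Horizontal displacement per unit of height: the denominator is nonzero on upward edges, and the
    upper covers of an element are ordered from left to right by it. *)
Definition slope x y := (X y - X x) / (Y y - Y x).

Definition seg x y s := X x + (s - Y x) * slope x y.

(* Abscissa at height [s] of the polyline through [x :: p]; the clamping makes
   continuity in [s] obvious. *)
Fixpoint polyline x p s :=
  if p is y :: p' then seg x y (Rmin s (Y y)) + polyline y p' (Rmax s (Y y)) - X y
  else X x.

Lemma covb_up a b : covb a b -> Y a < Y b.
Proof. by move/covbP/f_up. Qed.

Lemma le_up a b : (a <= b)%O -> Y a <= Y b.
Proof.
case/covb_path => p + <-; elim: p a => [|y p IH] a /=; first by move=> _; lra.
by case/andP=> /covb_up ay /IH; lra.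
Qed.

Lemma seg_start x y : seg x y (Y x) = X x.
Proof. by rewrite /seg; ring. Qed.

Lemma seg_end x y : covb x y -> seg x y (Y y) = X y.
Proof. by move/covb_up => xy; rewrite /seg /slope; field; lra. Qed.

Lemma on_seg_seg x y s : covb x y -> Y x <= s <= Y y -> on_seg (f x) (f y) (seg x y s, s).
Proof.
move/covb_up => xy [s0 s1]; exists ((s - Y x) / (Y y - Y x)); split; last first.
  by rewrite /seg /slope /=; split; field; lra.
have i0 : 0 < / (Y y - Y x) by apply: Rinv_0_lt_compat; lra.
split; first by apply: Rmult_le_pos; lra.
by apply: (Rmult_le_reg_r (Y y - Y x)); [lra|]; field_simplify; lra.
Qed.

Lemma polyline_start x p : path (@covb _ L) x p -> polyline x p (Y x) = X x.
Proof.
elim: p x => [//|y p IH] x /= /andP[xy pp].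
have lt := covb_up xy.
by rewrite Rmin_left ?Rmax_right ?IH ?seg_start //; lra.
Qed.

Lemma polyline_first x y p s : path (@covb _ L) x (y :: p) -> s <= Y y ->
  polyline x (y :: p) s = seg x y s.
Proof.
move=> /= /andP[xy pp] sy.
by rewrite Rmin_left ?Rmax_right ?polyline_start //; lra.
Qed.

Lemma polyline_last x p : path (@covb _ L) x p ->
  polyline x p (Y (last x p)) = X (last x p).
Proof.
elim: p x => [//|y p IH] x /= /andP[xy pp].
have le : Y y <= Y (last y p).
  by apply/le_up/path_le_last => //; rewrite inE eqxx.
by rewrite Rmin_right ?Rmax_left ?IH ?seg_end //; lra.
Qed.

(** At each height the polyline follows a single edge, over the whole height range of that edge;
    this is what brings [f_planar] into play. *)
Lemma polyline_edge x p s : path (@covb _ L) x p -> p != [::] -> Y x <= s <= Y (last x p) ->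
  exists u v, [/\ covb u v, u \in x :: p, v \in x :: p, Y u <= s <= Y v &
    forall s', Y u <= s' <= Y v -> polyline x p s' = seg u v s'].
Proof.
elim: p x => [//|y p IH] x pp _ [xs sl].
have /andP[xy pp'] := pp.
have [sy|ys] := Rle_lt_dec s (Y y).
  exists x, y; split=> //; rewrite ?inE ?eqxx ?orbT // => s' [_ s'y].
  exact: polyline_first.
have np : p != [::] by move: sl; case: (p) => //=; lra.
have [|u [v [uv up vp us E]]] := IH y pp' np; first by split; [lra|].
exists u, v; split=> //; rewrite 1?inE ?up ?vp ?orbT // => s' s's.
have yu : Y y <= Y u by apply/le_up/(path_ge pp').
by rewrite /= Rmin_right ?Rmax_left -?E ?seg_end //; lra.
Qed.

Lemma continuous_Rmax (c : R) : continuity (fun s => Rmax s c).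
Proof.
have E s : Rmax s c = / 2 * (s + c + Rabs (s - c)).
  by rewrite /Rmax; case: Rle_dec => ?; [rewrite Rabs_left1|rewrite Rabs_right]; lra.
have cst (e : R) : continuity (fun=> e) by move=> t; exact: continuity_pt_const.
have idc : continuity (fun s => s) by exact/derivable_continuous/derivable_id.
have: continuity (fun s => / 2 * (s + c + Rabs (s - c))).
  apply: continuity_mult; first exact: cst.
  apply: continuity_plus; first by apply: continuity_plus.
  apply: (continuity_comp (fun s => s - c) Rabs); first by apply: continuity_minus.
  exact: Rcontinuity_abs.
move=> H s eps e0; have [al [al0 Hal]] := H s eps e0; exists al; split=> // t Ht.
by rewrite !E; exact: Hal.
Qed.

Lemma continuous_Rmin (c : R) : continuity (fun s => Rmin s c).
Proof.
have E s : Rmin s c = s + c - Rmax s c.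
  by rewrite /Rmin /Rmax; case: Rle_dec => ?; lra.
have: continuity (fun s => s + c - Rmax s c).
  apply: continuity_minus; last exact: continuous_Rmax.
  apply: continuity_plus; first exact/derivable_continuous/derivable_id.
  by move=> t; exact: continuity_pt_const.
move=> H s eps e0; have [al [al0 Hal]] := H s eps e0; exists al; split=> // t Ht.
by rewrite !E; exact: Hal.
Qed.

Lemma continuous_polyline x p : continuity (polyline x p).
Proof.
elim: p x => [|y p IH] x /=; first by move=> t; exact: continuity_pt_const.
have cst (e : R) : continuity (fun=> e) by move=> t; exact: continuity_pt_const.
apply: continuity_minus; last exact: cst.
apply: continuity_plus.
  apply: continuity_plus; first exact: cst.
  apply: continuity_mult; last exact: cst.
  by apply: continuity_minus; [exact: continuous_Rmin|exact: cst].
exact: (continuity_comp (fun s => Rmax s (Y y)) _ (@continuous_Rmax _) (IH y)).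
Qed.

(* Two polylines that change sides between the heights [s0] and [s1] meet by the
   intermediate value theorem, and by planarity they can only meet at a vertex. *)
Lemma polyline_crossing x p y q s0 s1 :
  path (@covb _ L) x p -> path (@covb _ L) y q -> s0 < s1 ->
  Y x <= s0 -> s1 <= Y (last x p) -> Y y <= s0 -> s1 <= Y (last y q) ->
  polyline x p s0 < polyline y q s0 /\ polyline y q s1 <= polyline x p s1 \/
  polyline x p s0 <= polyline y q s0 /\ polyline y q s1 < polyline x p s1 ->
  exists z, [/\ z \in x :: p, z \in y :: q & s0 <= Y z <= s1].
Proof.
move=> pp qq s01 xs0 s1p ys0 s1q sgn.
have np : p != [::] by apply: contraTneq pp => E; move: s1p; rewrite E /=; lra.
have nq : q != [::] by apply: contraTneq qq => E; move: s1q; rewrite E /=; lra.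
have [|||s [s01s E]] := IVT_cor (fun s => polyline x p s - polyline y q s) s0 s1.
- by apply: continuity_minus; apply: continuous_polyline.
- lra.
- case: sgn => -[? ?]; nra.
have [|u [v [uv up vp us Ep]]] := polyline_edge (s := s) pp np; first lra.
have [|u' [v' [uv' uq vq us' Eq]]] := polyline_edge (s := s) qq nq; first lra.
have [[Eu Ev]|] := eqVneq (u, v) (u', v').
  (* Both polylines run along the same edge. Either one of its ends has its height in the range, or
     the edge spans the whole range and the polylines coincide there, against the strict inequality
     in [sgn]. *)
  subst u' v'; have [su|su] := Rlt_le_dec s0 (Y u); first by exists u; split=> //; lra.
  have [sv|sv] := Rle_lt_dec (Y v) s1; first by exists v; split=> //; lra.
  by move: sgn; rewrite !Ep ?Eq; lra.
move=> /eqP neq.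
have [||z [Ez [zuv zuv']]] := f_planar (P := (seg u v s, s)) (elimT (covbP _ _) uv)
    (elimT (covbP _ _) uv') neq; first exact: on_seg_seg.
  have -> : seg u v s = seg u' v' s by rewrite -Ep // -Eq //; lra.
  exact: on_seg_seg.
exists z; split; [by case: zuv => ->|by case: zuv' => ->|].
by rewrite -Ez /=; lra.
Qed.

(** Two such edges overlap up to the lower of the heights of [b] and [c]. Their common point at that
    height would have to be a vertex shared by both edges and distinct from [a]. *)
Lemma slope_inj a b c : covb a b -> covb a c -> slope a b = slope a c -> b = c.
Proof.
move=> ab ac E; apply/eqP/negPn/negP => bc.
have lb := covb_up ab; have lc := covb_up ac.
pose s := Rmin (Y b) (Y c).
have [sb sc sa] : [/\ s <= Y b, s <= Y c & Y a < s].
  by split; [exact: Rmin_l|exact: Rmin_r|exact: Rmin_glb_lt].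
have neq : (a, b) <> (a, c) by case=> /eqP; rewrite (negPf bc).
have [||z [Ez [zb zc]]] := f_planar (P := (seg a b s, s)) (elimT (covbP _ _) ab)
    (elimT (covbP _ _) ac) neq; first by apply: on_seg_seg => //; lra.
  by rewrite /seg E; apply: on_seg_seg => //; lra.
have za : z <> a by move=> za; move: sa; rewrite -za -Ez /=; lra.
case: zb => // zb; case: zc => // zc.
by move: bc; rewrite -zb zc eqxx.
Qed.

(** For [e] between [b] and the join, modularity writes [e] as the join of [b] with the meet of [c]
    and [e]. That meet is [a] or [c], so [e] is one of the two ends. *)
Lemma modular_covb_join a b c : covb a b -> covb a c -> b != c -> covb b (b `|` c)%O.
Proof.
move=> ab ac bc.
have lt : (b < b `|` c)%O.
  rewrite lt_neqAle leUl andbT; apply/eqP => E.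
  by have := covb_uncomparable ac ab; rewrite eq_sym bc E leUr => /(_ isT).
apply/andP; split=> //; apply/forallP => e; apply/negP => /andP[be eb].
have := modL c (ltW be).
have le_ac := ltW (covb_lt ac); have le_ae := le_trans (ltW (covb_lt ab)) (ltW be).
rewrite (meet_r (ltW eb)).
have := @covb_between _ _ a c (c `&` e)%O ac; rewrite lexI le_ac le_ae leIl => /(_ isT isT).
case=> ->.
  by rewrite join_l ?(ltW (covb_lt ab)) // => E; rewrite E ltxx in be.
by move=> E; rewrite E ltxx in eb.
Qed.

(** * Elements with three upper covers *)

Section ThreeCovers.

Variables a b1 b2 b3 : L.
Hypotheses (ab1 : covb a b1) (ab2 : covb a b2) (ab3 : covb a b3).
Hypotheses (s12 : slope a b1 < slope a b2) (s23 : slope a b2 < slope a b3).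

Local Notation t := (b1 `|` b3)%O.

Lemma three_distinct : [/\ b1 != b2, b2 != b3 & b1 != b3].
Proof. by split; apply/eqP => E; move: s12 s23; rewrite E; lra. Qed.

(** Up to the lowest of the three covers, polylines leaving [a] through them are still on their
    first edges and hence ordered by slope. *)
Lemma three_order_start : exists s0, [/\ Y a < s0, s0 <= Y b1, s0 <= Y b2, s0 <= Y b3 &
  seg a b1 s0 < seg a b2 s0 < seg a b3 s0].
Proof.
have l1 := covb_up ab1; have l2 := covb_up ab2; have l3 := covb_up ab3.
exists (Rmin (Y b1) (Rmin (Y b2) (Y b3))).
have := Rmin_l (Y b1) (Rmin (Y b2) (Y b3)).
have := Rmin_r (Y b1) (Rmin (Y b2) (Y b3)).
have := Rmin_l (Y b2) (Y b3).
have := Rmin_r (Y b2) (Y b3).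
have : Y a < Rmin (Y b1) (Rmin (Y b2) (Y b3)) by do 2!apply: Rmin_glb_lt => //.
move: (Rmin _ (Rmin _ _)) => s h0 h1 h2 h3 h4.
by split; try lra; rewrite /seg; split; nra.
Qed.

(** The last clause serves crossings: a vertex higher than [a] that is common to two such chains
    lies above both of their first covers. *)
Lemma edge_path x y : covb a x -> (x <= y)%O ->
  exists p, [/\ path (@covb _ L) a (x :: p), last a (x :: p) = y &
    forall z, z \in a :: x :: p -> Y a < Y z -> (x <= z)%O].
Proof.
move=> ax /covb_path[p pp lp]; exists p; split; rewrite //= ?ax //.
move=> z; rewrite inE => /predU1P[->|/(path_ge pp)//]; lra.
Qed.

(** A chain through [b2] starts between two chains that go through [b1] and [b3] to [t]. At the
    height of [t] it has reached one side of [t] or [t] itself, so it has met one of the two chains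
    at a vertex, which is below [t] and above both first covers. *)
Lemma three_middle_le : (b1 `|` b2 <= t)%O \/ (b2 `|` b3 <= t)%O.
Proof.
have [s0 [s0a s01 s02 s03 [o12 o23]]] := three_order_start.
have [p1 [pp1 l1 q1]] := edge_path ab1 (leUl b1 b3).
have [p3 [pp3 l3 q3]] := edge_path ab3 (leUr b3 b1).
have [p2 [pp2 l2 q2]] := edge_path ab2 (leUl b2 t).
have ht1 := le_up (leUl b1 b3); have ht2 := le_up (leUr t b2).
have e1 := polyline_last pp1; have e3 := polyline_last pp3.
rewrite l1 in e1; rewrite l3 in e3.
have lt0 : s0 <= Y t by lra.
have b1t : (b1 < t)%O.
  rewrite lt_neqAle leUl andbT; apply/eqP => E.
  have [_ _ n13] := three_distinct.
  by have := covb_uncomparable ab3 ab1; rewrite eq_sym n13 E leUr => /(_ isT).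
have ltt : Y b1 < Y t.
  have [b /covb_up ? /le_up ?] := covb_above b1t; lra.
have [le|lt] := Rle_lt_dec (polyline a (b2 :: p2) (Y t)) (X t).
  left; have [||||||||z [z1 z2 hz]] := @polyline_crossing a (b1 :: p1) a (b2 :: p2) s0 (Y t);
    rewrite ?l1 ?l2 //; try lra.
    by left; rewrite e1 (polyline_first pp1 s01) (polyline_first pp2 s02).
  have zt : (z <= t)%O by rewrite -l1 (path_le_last pp1 z1).
  apply: le_trans zt; rewrite leUx q1 ?q2 //; lra.
right; have [||||||||z [z2 z3 hz]] := @polyline_crossing a (b2 :: p2) a (b3 :: p3) s0 (Y t);
    rewrite ?l2 ?l3 //; try lra.
  by left; rewrite e3 (polyline_first pp2 s02) (polyline_first pp3 s03); split=> //; lra.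
have zt : (z <= t)%O by rewrite -l3 (path_le_last pp3 z3).
apply: le_trans zt; rewrite leUx q2 ?q3 //; lra.
Qed.

(** Now [b2 <= t], and [t] covers [b1] and [b3]. Each of the two joins lies between a cover of [a]
    and [t], and differs from that cover because distinct covers are incomparable. *)
Lemma three_join_middle : (b1 `|` b2 = t)%O /\ (b2 `|` b3 = t)%O.
Proof.
have [n12 n23 n13] := three_distinct.
have c13 := modular_covb_join ab1 ab3 n13.
have n31 : b3 != b1 by rewrite eq_sym.
have n21 : b2 != b1 by rewrite eq_sym.
have c31 := modular_covb_join ab3 ab1 n31; rewrite joinC in c31.
have b2t : (b2 <= t)%O by case: three_middle_le; rewrite leUx => /andP[].
have E1 : (b1 `|` b2 = t)%O.
  have le : (b1 `|` b2 <= t)%O by rewrite leUx leUl.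
  case: (covb_between c13 (leUl _ _) le) => // E.
  by case/negP: (covb_uncomparable ab2 ab1 n21); rewrite -E leUr.
split=> //.
have le : (b2 `|` b3 <= t)%O by rewrite leUx leUr andbT.
case: (covb_between c31 (leUr _ _) le) => // E.
by case/negP: (covb_uncomparable ab2 ab3 n23); rewrite -E leUl.
Qed.

Lemma three_covb_top : [/\ covb b1 t, covb b2 t & covb b3 t].
Proof.
have [n12 n23 n13] := three_distinct; have [E1 E2] := three_join_middle.
split; first exact: modular_covb_join ab1 ab3 n13.
  by rewrite -E2; exact: modular_covb_join ab2 ab3 n23.
by rewrite joinC; apply: modular_covb_join ab3 ab1 _; rewrite eq_sym.
Qed.

Lemma three_edge_path b : covb a b -> covb b t -> path (@covb _ L) a [:: b; t].
Proof. by move=> /= -> ->. Qed.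

(** A chain through [b2] and [c] is enclosed by the chains [a], [b1], [t] and [a], [b3], [t], so by
    the height of [t] it meets one of them above [a]. The common vertex can only be [t], hence
    [c <= t], and [t] covers [b2]. *)
Lemma three_middle_upper c : covb b2 c -> c = t.
Proof.
move=> b2c.
have [s0 [s0a s01 s02 s03 [o12 o23]]] := three_order_start.
have [n12 n23 n13] := three_distinct; have [c1 c2 c3] := three_covb_top.
have pp1 := three_edge_path ab1 c1; have pp3 := three_edge_path ab3 c3.
have [p pp lp] := covb_path (leUl c t).
have pp2 : path (@covb _ L) a (b2 :: c :: p) by rewrite /= ab2 b2c pp.
have l1 : last a [:: b1; t] = t by []; have l3 : last a [:: b3; t] = t by [].
have lp2 : last a [:: b2, c & p] = (c `|` t)%O by [].
have e1 := polyline_last pp1; have e3 := polyline_last pp3.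
rewrite l1 in e1; rewrite l3 in e3.
have ht1 := covb_up c1; have ht3 := covb_up c3; have ht2 := le_up (leUr t c).
have key b z : covb a b -> b != b2 -> z \in [:: a; b; t] -> z \in a :: b2 :: c :: p ->
    Y a < Y z -> c = t.
  move=> ab bb2 z1 z2 hz.
  have za : z == a = false by apply/eqP => E; move: hz; rewrite E; lra.
  move: z1 z2; rewrite !(inE, za) /= => z1 /orP[/eqP zb|].
    move: z1; rewrite zb eq_sym (negPf bb2) /= => /eqP E.
    by have := covb_lt c2; rewrite -E ltxx.
  rewrite -in_cons => /(path_ge pp) cz.
  case/orP: z1 => /eqP E; rewrite {}E in cz.
    have := covb_uncomparable ab2 ab; rewrite eq_sym bb2 => /(_ isT)/negP[].
    by apply: le_trans cz; apply/ltW/covb_lt.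
  case: (covb_between c2 (ltW (covb_lt b2c)) cz) => // E.
  by have := covb_lt b2c; rewrite E ltxx.
have [le|lt] := Rle_lt_dec (polyline a (b2 :: c :: p) (Y t)) (X t).
  have [||||||||z [z1 z2 hz]] := @polyline_crossing a [:: b1; t] a (b2 :: c :: p) s0 (Y t) => //;
    rewrite ?l1 ?lp2; try lra.
    by left; rewrite e1 (polyline_first pp1 s01) (polyline_first pp2 s02).
  by apply: (key b1 z) => //; lra.
have [||||||||z [z2 z3 hz]] := @polyline_crossing a (b2 :: c :: p) a [:: b3; t] s0 (Y t) => //;
  rewrite ?l3 ?lp2; try lra.
  by left; rewrite e3 (polyline_first pp2 s02) (polyline_first pp3 s03); split=> //; apply: Rlt_le.
by apply: (key b3 z) => //; [rewrite eq_sym|lra].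
Qed.

(** A chain from the meet of [c] and [a] through [c] ends at [b2], strictly between the chains
    through [b1] and [b3]. At the height of [a] it passes on one side of [a] or through it, so it
    meets one of those chains on the way. The common vertex lies below [c] and is [a] or a cover of
    [a]; only [a] is possible, and then [a <= c < b2]. *)
Lemma three_middle_lower c : covb c b2 -> c = a.
Proof.
move=> cb2.
have [s0 [s0a s01 s02 s03 [o12 o23]]] := three_order_start.
have [n12 n23 n13] := three_distinct; have [c1 c2 c3] := three_covb_top.
have pp1 := three_edge_path ab1 c1; have pp2 := three_edge_path ab2 c2.
have pp3 := three_edge_path ab3 c3.
have h2 := covb_up c2; have ha2 := covb_up ab2.
have l1 : last a [:: b1; t] = t by []; have l2 : last a [:: b2; t] = t by [].
have l3 : last a [:: b3; t] = t by [].
have d2 : polyline a [:: b2; t] (Y b2) = X b2.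
  by rewrite polyline_first ?seg_end //; lra.
have mid b z : z \in [:: a; b; t] -> b != b2 -> z \in [:: a; b2; t] -> s0 <= Y z <= Y b2 -> False.
  move=> z1 bb2 + hz.
  have za : z == a = false by apply/eqP => E; move: hz; rewrite E; lra.
  have zt : z == t = false by apply/eqP => E; move: hz; rewrite E; lra.
  move: z1; rewrite !(inE, za, zt) !orbF /= => /eqP-> /eqP E.
  by rewrite E eqxx in bb2.
have n32 : b3 != b2 by rewrite eq_sym.
(* At the height of [b2] the three chains keep their order, since they share only [a] and [t], whose
   heights lie outside the range from [s0] to [Y b2]. If that range is a single height, the first
   edges decide. *)
have lts : s0 < Y b2 \/ s0 = Y b2 by lra.
have o1 : polyline a [:: b1; t] (Y b2) < X b2.
  have [//|le] := Rlt_le_dec (polyline a [:: b1; t] (Y b2)) (X b2).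
  case: lts => [lts|E]; last first.
    by move: le; rewrite polyline_first -?E ?E -?(seg_end ab2) -?E //; lra.
  have [||||||||z [z1 z2 hz]] := @polyline_crossing a [:: b1; t] a [:: b2; t] s0 (Y b2) => //; rewrite ?l1 ?l2 ?l3; try lra.
    by rewrite d2; left; split=> //; rewrite (polyline_first pp1 s01) (polyline_first pp2 s02).
  by case: (mid b1 z).
have o3 : X b2 < polyline a [:: b3; t] (Y b2).
  have [//|le] := Rlt_le_dec (X b2) (polyline a [:: b3; t] (Y b2)).
  case: lts => [lts|E]; last first.
    by move: le; rewrite polyline_first -?E ?E -?(seg_end ab2) -?E //; lra.
  have [||||||||z [z2 z3 hz]] := @polyline_crossing a [:: b2; t] a [:: b3; t] s0 (Y b2) => //; rewrite ?l1 ?l2 ?l3; try lra.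
    by rewrite d2; left; split=> //; rewrite (polyline_first pp2 s02) (polyline_first pp3 s03).
  by case: (mid b3 z).
have [p pp lp] := covb_path (leIl c a).
have ppb : path (@covb _ L) (c `&` a)%O (rcons p b2) by rewrite rcons_path pp lp.
have eb := polyline_last ppb; rewrite last_rcons in eb.
have hca := le_up (leIr a c).
have key b z : covb a b -> b != b2 -> z \in [:: a; b; t] -> z \in (c `&` a)%O :: rcons p b2 ->
    Y a <= Y z <= Y b2 -> c = a.
  move=> ab bb2 z1 z2 hz.
  have zt : z == t = false by apply/eqP => E; move: hz; rewrite E; lra.
  have zb2 : z == b2 = false.
    move: z1; rewrite !(inE, zt) orbF => /orP[]/eqP->; last exact: negPf.
    by apply/eqP => E; move: ha2; rewrite E; lra.
  move: z2; rewrite -rcons_cons mem_rcons inE zb2 /= => /(path_le_last pp).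
  rewrite lp => zc; move: z1; rewrite !(inE, zt) orbF => /orP[]/eqP E; rewrite {}E in zc.
    case: (covb_between ab2 zc (ltW (covb_lt cb2))) => // E.
    by have := covb_lt cb2; rewrite E ltxx.
  have := covb_uncomparable ab ab2 bb2 => /negP[].
  by apply: le_trans zc _; apply/ltW/covb_lt.
have st1 := polyline_start pp1; have st3 := polyline_start pp3.
have [le|lt] := Rle_lt_dec (polyline (c `&` a)%O (rcons p b2) (Y a)) (X a).
  have [||||||||z [z2 z1 hz]] := @polyline_crossing (c `&` a)%O (rcons p b2) a [:: b1; t] (Y a) (Y b2) => //;
    rewrite ?last_rcons ?l1 //; try exact: hca; try lra.
  exact: key z1 z2 hz.
have [||||||||z [z3 z2 hz]] := @polyline_crossing a [:: b3; t] (c `&` a)%O (rcons p b2) (Y a) (Y b2) => //;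
  rewrite ?last_rcons ?l3 //; try exact: hca; try lra.
exact: key z3 z2 hz.
Qed.

End ThreeCovers.

End Drawing.

(** * Frames of planar modular lattices *)

Section Frame.

Variables (d : Order.disp_t) (L : finLatticeType d).
Implicit Types (a b c e x y z : L).

Local Open Scope order_scope.

Lemma covb_below x y : x < y -> exists2 c, covb c y & x <= c.
Proof.
move=> xy; have [p] := covb_path (ltW xy); case: (lastP p) => [|q z] + E.
  by move: E xy => /= ->; rewrite ltxx.
rewrite last_rcons in E; rewrite E rcons_path => /andP[xq qy].
by exists (last x q); rewrite // path_le_last // inE eqxx.
Qed.

Definition isolated a e :=
  [forall c, covb c e ==> (c == a)] &&
  [forall c, forall c', covb e c && covb e c' ==> (c == c')].

Lemma isolated_lower a e c : isolated a e -> covb c e -> c = a.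
Proof. by case/andP=> /forallP/(_ c)/implyP H _ /H/eqP. Qed.

Lemma isolated_upper a e c c' : isolated a e -> covb e c -> covb e c' -> c = c'.
Proof.
by case/andP=> _ /forallP/(_ c)/forallP/(_ c')/implyP H ec ec'; apply/eqP/H; rewrite ec.
Qed.

(* The eyes are the interior atoms of the intervals [a, l a `|` r a] isomorphic
   to some M_k with k >= 3; every element has at most two non-eye covers. *)
Record frame (eye : pred L) (l r base : L -> L) : Prop := Frame {
  frame_max : forall a, (forall y, ~~ (a < y)) -> l a = a /\ r a = a;
  frame_l : forall a y, a < y -> covb a (l a) /\ ~~ eye (l a);
  frame_r : forall a y, a < y -> covb a (r a) /\ ~~ eye (r a);
  frame_above : forall a y, a < y -> ~~ eye y -> (l a <= y) || (r a <= y);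
  frame_base : forall e, eye e -> covb (base e) e /\ ~~ eye (base e);
  frame_below : forall e x, eye e -> x < e -> x <= base e;
  frame_top : forall e, eye e -> let t := l (base e) `|` r (base e) in
    [/\ e < t, ~~ eye t, e `|` l (base e) = t & e `|` r (base e) = t];
  frame_over : forall e x, eye e -> e < x -> l (base e) `|` r (base e) <= x;
  frame_eyes : forall e e', eye e -> eye e' -> base e = base e' -> e != e' ->
    e `|` e' = l (base e) `|` r (base e) }.

Hypothesis modL : modular_lattice L.

Section Build.

Hypothesis three_joins : forall a b1 b2 b3, covb a b1 -> covb a b2 -> covb a b3 ->
  uniq [:: b1; b2; b3] -> b1 `|` b2 = b1 `|` b3.
Hypothesis three_isolated : forall a b1 b2 b3, covb a b1 -> covb a b2 -> covb a b3 ->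
  uniq [:: b1; b2; b3] -> [|| isolated a b1, isolated a b2 | isolated a b3].

(** Of any three covers one is isolated, so at most two are not. Choosing [l] and [r] among the
    non-isolated ones first leaves only isolated covers over. *)
Lemma frame_pair a : exists lr : L * L,
  (forall y, ~~ (a < y)) /\ lr = (a, a) \/
  [/\ covb a lr.1, covb a lr.2 &
    forall b, covb a b -> [\/ b = lr.1, b = lr.2 | isolated a b /\ lr.1 != lr.2]].
Proof.
have [/existsP[b0 ab0]|] := boolP [exists b, covb a b]; last first.
  move/existsPn=> noc; exists (a, a); left; split=> // y; apply/negP => /covb_above[b ab _].
  by have := noc b; rewrite ab.
pose N b := covb a b && ~~ isolated a b.
have [l [al lN]] : exists l, covb a l /\ forall b, N b -> N l.
  have [/existsP[l Nl]|/existsPn noN] := boolP [exists b, N b].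
    by exists l; split=> //; case/andP: Nl.
  by exists b0; split=> // b Nb; have := noN b; rewrite Nb.
have [r [ar rl rN]] : exists r, [/\ covb a r, forall b, covb a b -> b != l -> r != l &
    forall b, N b -> b != l -> N r].
  have [/existsP[r /andP[Nr rl]]|/existsPn noN] := boolP [exists b, N b && (b != l)].
    by exists r; split=> //; case/andP: Nr.
  have {}noN b : N b -> b != l -> False by move=> Nb bl; have := noN b; rewrite Nb bl.
  have [/existsP[r /andP[ar rl]]|/existsPn noc] := boolP [exists b, covb a b && (b != l)].
    by exists r; split=> // b Nb bl; case: (noN b).
  exists l; split=> // b ab bl; last by case: (noN b).
  by have := noc b; rewrite ab bl.
exists (l, r); right; split=> //= b ab.
have [->|bl] := eqVneq b l; first by constructor 1.
have [->|br] := eqVneq b r; first by constructor 2.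
constructor 3; split; last by rewrite eq_sym (rl b).
apply/negPn/negP => nis; have Nb : N b by rewrite /N ab.
have /andP[_ nl] := lN _ Nb; have /andP[_ nr] := rN _ Nb bl.
have := three_isolated ab al ar; rewrite (negPf nis) (negPf nl) (negPf nr).
rewrite /= !inE negb_or bl br eq_sym (rl b) //.
by move=> /(_ isT).
Qed.

(** The eyes above [a] are its covers other than [l a] and [r a]; they are isolated. Bases and tops
    are not eyes, because a base has several upper covers and a top several lower ones. *)
Lemma frame_exists : exists eye l r base, frame eye l r base.
Proof.
have [lr lrP] := fin_all_exists frame_pair.
pose l a := (lr a).1; pose r a := (lr a).2.
pose eyeof a e := [&& covb a e, e != l a & e != r a].
pose eye e := [exists a, eyeof a e].
(* An isolated element covers only one element, so [pick] has no choice; the default [e] concerns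
   non-eyes only. *)
pose base e := odflt e [pick a | eyeof a e].
have pairP a b : covb a b -> [/\ covb a (l a), covb a (r a) &
    [\/ b = l a, b = r a | isolated a b /\ l a != r a]].
  move=> ab; case: (lrP a) => [[/(_ b)]|[al ar H]]; first by rewrite covb_lt.
  by split=> //; exact: H.
have eyeP a e : eyeof a e ->
    [/\ covb a e, covb a (l a), covb a (r a), uniq [:: e; l a; r a] & isolated a e].
  case/and3P=> ae el er; have [al ar [E|E|[is_e lr_neq]]] := pairP _ _ ae.
  - by rewrite E eqxx in el.
  - by rewrite E eqxx in er.
  by split=> //=; rewrite !inE negb_or el er lr_neq.
have baseP e : eye e -> eyeof (base e) e.
  by case/existsP=> a ae; rewrite /base; case: pickP => //= /(_ a); rewrite ae.
have base_eq a e : eyeof a e -> base e = a.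
  move=> ae; have /baseP ee : eye e by apply/existsP; exists a.
  have [_ _ _ _ is_e] := eyeP _ _ ae; have [be _ _ _ _] := eyeP _ _ ee.
  exact: isolated_lower is_e be.
have topP e : eye e -> let t := l (base e) `|` r (base e) in
    [/\ covb e t, covb (l (base e)) t, covb (r (base e)) t,
        e `|` l (base e) = t & e `|` r (base e) = t].
  move=> /baseP/eyeP[ae al ar u is_e] t.
  have Er : e `|` l (base e) = e `|` r (base e) by exact: three_joins ae al ar u.
  have u' : uniq [:: l (base e); e; r (base e)].
    by move: u; rewrite /= !inE !negb_or !andbT => /andP[/andP[nl ->] ->]; rewrite eq_sym nl.
  have El : l (base e) `|` e = t by exact: three_joins al ae ar u'.
  have [nel ner nlr] : [/\ e != l (base e), e != r (base e) & l (base e) != r (base e)].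
    by move: u; rewrite /= !inE !negb_or !andbT => /andP[/andP[-> ->] ->].
  split; last by rewrite -Er joinC.
  - by rewrite -El joinC; exact: (modular_covb_join modL ae al nel).
  - by exact: (modular_covb_join modL al ar nlr).
  - by rewrite /t joinC; apply: (modular_covb_join modL ar al); rewrite eq_sym.
  - by rewrite joinC.
(* If [l a] were an eye over some base, isolation would make that base equal to [a], whose eyes
   differ from [l a] by definition. *)
have neyel a b : covb a b -> ~~ eye (l a) /\ ~~ eye (r a).
  move=> /pairP[al ar _].
  by split; apply/negP => /baseP ee; have [_ _ _ _ is_e] := eyeP _ _ ee;
     have E := isolated_lower is_e; [rewrite -(E _ al) in ee|rewrite -(E _ ar) in ee];
     case/and3P: ee; rewrite eqxx.
have overP e x : eye e -> e < x -> l (base e) `|` r (base e) <= x.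
  move=> ee /covb_above[c ec cx]; have [et _ _ _ _] := topP _ ee.
  have [_ _ _ _ is_e] := eyeP _ _ (baseP _ ee).
  by rewrite (isolated_upper is_e et ec).
exists eye, l, r, base; split.
- move=> a nay; case: (lrP a) => [[_ E]|[al _ _]]; first by rewrite /l /r E.
  by have := nay (lr a).1; rewrite covb_lt.
- move=> a y /covb_above[b ab _]; have [al _ _] := pairP _ _ ab.
  by have [] := neyel _ _ ab.
- move=> a y /covb_above[b ab _]; have [_ ar _] := pairP _ _ ab.
  by have [] := neyel _ _ ab.
- move=> a y /covb_above[b ab le_by] ney.
  have [/eqP <-|bl] := boolP (b == l a); first by rewrite le_by.
  have [/eqP <-|br] := boolP (b == r a); first by rewrite le_by orbT.
  have eb : eyeof a b by rewrite /eyeof ab bl br.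
  have eyeb : eye b by apply/existsP; exists a.
  have lt_by : b < y by rewrite lt_neqAle le_by andbT; apply: contraNneq ney => <-.
  have := overP _ _ eyeb lt_by; rewrite (base_eq _ _ eb) leUx => /andP[-> //].
- move=> e /baseP ee; have [ae al ar u _] := eyeP _ _ ee; split=> //.
  apply/negP => /baseP/eyeP[_ _ _ _ is_a]; have E := isolated_upper is_a ae al.
  by move: u; rewrite /= inE -E eqxx.
- move=> e x /baseP/eyeP[_ _ _ _ is_e] /covb_below[c ce xc].
  by rewrite -(isolated_lower is_e ce).
- move=> e ee t; have [et lt rt El Er] := topP _ ee; split=> //; first exact: covb_lt.
  apply/negP => /baseP/eyeP[_ _ _ _ is_t].
  have E : l (base e) = r (base e).
    by rewrite (isolated_lower is_t lt) (isolated_lower is_t rt).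
  by have [_ _ _] := eyeP _ _ (baseP _ ee); rewrite /= !inE E eqxx andbF.
- exact: overP.
- move=> e e' ee ee' E neq; have [_ _ _ <- _] := topP _ ee.
  have [ae al ar u _] := eyeP _ _ (baseP _ ee).
  have [ae' _ _ u' _] := eyeP _ _ (baseP _ ee').
  rewrite -E in ae' u'; apply: three_joins ae ae' al _.
  by move: u u'; rewrite /= !inE !negb_or neq => /andP[/andP[-> _] _] /andP[/andP[-> _] _].
Qed.

End Build.

(** Distinct covers of an element have distinct slopes. Among three of them the one with the middle
    slope is isolated and has the same join with each of the outer two as they have with each other;
    the rest is sorting by slope. *)
Theorem planar_frame : planar_lattice L -> exists eye l r base, frame eye l r base.
Proof.
case=> f [_ [f_up [_ f_planar]]].
pose sl := slope f.
have key a b1 b2 b3 : covb a b1 -> covb a b2 -> covb a b3 ->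
    Rlt (sl a b1) (sl a b2) -> Rlt (sl a b2) (sl a b3) ->
    [/\ b1 `|` b2 = b1 `|` b3, b2 `|` b3 = b1 `|` b3 & isolated a b2].
  move=> ab1 ab2 ab3 s12 s23.
  have [E1 E2] := three_join_middle modL f_up f_planar ab1 ab2 ab3 s12 s23.
  split=> //; apply/andP; split.
    apply/forallP => c; apply/implyP => cb2; apply/eqP.
    exact: (three_middle_lower modL f_up f_planar ab1 ab2 ab3 s12 s23 cb2).
  apply/forallP => c; apply/forallP => c'; apply/implyP => /andP[b2c b2c']; apply/eqP.
  have H := three_middle_upper modL f_up f_planar ab1 ab2 ab3 s12 s23.
  by rewrite (H _ b2c) (H _ b2c').
have total a b c : covb a b -> covb a c -> b != c ->
    Rlt (sl a b) (sl a c) \/ Rlt (sl a c) (sl a b).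
  move=> ab ac; have [|[|]] := Rtotal_order (sl a b) (sl a c); try by [left|right].
  by move/(slope_inj f_up f_planar ab ac) => ->; rewrite eqxx.
have three a b1 b2 b3 : covb a b1 -> covb a b2 -> covb a b3 -> uniq [:: b1; b2; b3] ->
    b1 `|` b2 = b1 `|` b3 /\ [|| isolated a b1, isolated a b2 | isolated a b3].
  move=> c1 c2 c3; rewrite /= !inE negb_or andbT => /andP[/andP[n12 n13] n23].
  have [s12|s21] := total _ _ _ c1 c2 n12; have [s23|s32] := total _ _ _ c2 c3 n23.
  - by have [-> _ ->] := key _ _ _ _ c1 c2 c3 s12 s23; rewrite orbT.
  - have [s13|s31] := total _ _ _ c1 c3 n13.
      by have [-> E ->] := key _ _ _ _ c1 c3 c2 s13 s32; rewrite !orbT.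
    by have [E1 E2 ->] := key _ _ _ _ c3 c1 c2 s31 s12; rewrite E2 -E1 joinC.
  - have [s13|s31] := total _ _ _ c1 c3 n13.
      by have [E1 E2 ->] := key _ _ _ _ c2 c1 c3 s21 s13; rewrite E2 -E1 joinC.
    have [E1 E2 ->] := key _ _ _ _ c2 c3 c1 s23 s31; rewrite !orbT; split=> //.
    by rewrite [b1 `|` b2]joinC -E2 joinC.
  - have [E1 E2 ->] := key _ _ _ _ c3 c2 c1 s32 s21; rewrite orbT; split=> //.
    by rewrite [b1 `|` b2]joinC E2 joinC.
by apply: frame_exists => a b1 b2 b3 c1 c2 c3 u; have [] := three _ _ _ _ c1 c2 c3 u.
Qed.

End Frame.

(** * Finite sums of reals and integer parts *)

Section RealSums.

Local Open Scope R_scope.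

Fact Rplus_associative : associative Rplus.
Proof. by move=> x y z; rewrite Rplus_assoc. Qed.

HB.instance Definition _ := Monoid.isComLaw.Build R 0 Rplus Rplus_associative Rplus_comm Rplus_0_l.
HB.instance Definition _ := Monoid.isMulLaw.Build R 0 Rmult Rmult_0_l Rmult_0_r.
HB.instance Definition _ :=
  Monoid.isAddLaw.Build R Rmult Rplus Rmult_plus_distr_r Rmult_plus_distr_l.

Variable I : Type.
Implicit Types (s : seq I) (P : pred I) (F G : I -> R).

Lemma rsum_ge0 s P F : (forall i, P i -> 0 <= F i) -> 0 <= \big[Rplus/0]_(i <- s | P i) F i.
Proof.
by move=> F0; elim/big_ind: _ => //= [|x y]; [exact: Rle_refl|exact: Rplus_le_le_0_compat].
Qed.

Lemma rsum_le s P F G : (forall i, P i -> F i <= G i) ->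
  \big[Rplus/0]_(i <- s | P i) F i <= \big[Rplus/0]_(i <- s | P i) G i.
Proof.
move=> FG; elim/big_ind2: _ => //= [|x y z t]; [exact: Rle_refl|exact: Rplus_le_compat].
Qed.

Lemma rsum_sub s P F G : \big[Rplus/0]_(i <- s | P i) (F i - G i) =
  \big[Rplus/0]_(i <- s | P i) F i - \big[Rplus/0]_(i <- s | P i) G i.
Proof.
elim: s => [|i s IH]; rewrite ?big_nil ?big_cons; first by ring.
by case: ifP => // _; rewrite IH; ring.
Qed.

End RealSums.

Section RealFinSums.

Local Open Scope R_scope.

Variable I : finType.
Implicit Types (A B P : pred I) (F : I -> R).

Lemma rsum_const A c : \big[Rplus/0]_(i in A) c = INR #|A| * c.
Proof.
rewrite big_const; elim: #|_| => [|n IH]; first by rewrite /= Rmult_0_l.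
by rewrite iterS IH S_INR; ring.
Qed.

Lemma rsum_constT c : \big[Rplus/0]_(i : I) c = INR #|I| * c.
Proof. by rewrite -rsum_const; apply: eq_bigl. Qed.

Lemma rsum_nat A (F : I -> nat) : INR (\sum_(i | A i) F i) = \big[Rplus/0]_(i | A i) INR (F i).
Proof. by apply: (big_morph INR) => // x y; rewrite -plusE plus_INR. Qed.

Lemma rsum_subset A B F : (forall i, A i -> B i) -> (forall i, B i -> 0 <= F i) ->
  \big[Rplus/0]_(i | A i) F i <= \big[Rplus/0]_(i | B i) F i.
Proof.
move=> AB F0; rewrite big_mkcond [X in _ <= X]big_mkcond; apply: rsum_le => i _.
by case: ifP => [/AB -> |_]; [exact: Rle_refl|case: ifP => [/F0//|_]; exact: Rle_refl].
Qed.

Lemma rsum_indic P F : \big[Rplus/0]_(i | P i) F i = \big[Rplus/0]_i (INR (P i) * F i).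
Proof.
by rewrite big_mkcond; apply: eq_bigr => i _; case: (P i) => /=; ring.
Qed.

End RealFinSums.

Section Floor.

Local Open Scope R_scope.

Definition rfloor (r : R) : nat := Z.to_nat (Int_part r).

Lemma rfloorP r : 0 <= r -> INR (rfloor r) <= r < INR (rfloor r) + 1.
Proof.
move=> r0; have [lo hi] := base_Int_part r.
have i0 : Z.lt (Zneg xH) (Int_part r) by apply: lt_IZR; lra.
by rewrite /rfloor INR_IZR_INZ Z2Nat.id; [lra|lia].
Qed.

End Floor.

(** * Polymatroids on a frame *)

Section Weights.

Variables (d : Order.disp_t) (L : finLatticeType d).
Implicit Types (a b e x y z : L).

(** An element with the most elements below it absorbs every join. The point [x0] excludes the empty
    lattice. *)
Lemma top_exists (x0 : L) : exists tp : L, forall y, (y <= tp)%O.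
Proof.
have P0 : predT x0 by [].
case: (arg_maxnP (fun x => #|[set z | (z <= x)%O]|) P0) => tp _ tpmax.
exists tp => y; have := tpmax (tp `|` y)%O isT; rewrite /geq /= leqNgt => /negP H.
apply/negPn/negP => nle; apply: H; apply: proper_card; apply/properP; split.
  by apply/subsetP => z; rewrite !inE => /le_trans; apply; rewrite leUl.
by exists y; rewrite !inE ?leUr.
Qed.

Lemma bot_exists (x0 : L) : exists bt : L, forall y, (bt <= y)%O.
Proof.
have P0 : predT x0 by [].
case: (arg_maxnP (fun x => #|[set z | (x <= z)%O]|) P0) => bt _ btmax.
exists bt => y; have := btmax (bt `&` y)%O isT; rewrite /geq /= leqNgt => /negP H.
apply/negPn/negP => nle; apply: H; apply: proper_card; apply/properP; split.
  by apply/subsetP => z; rewrite !inE => /(le_trans _); apply; rewrite leIl.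
by exists y; rewrite !inE ?leIr.
Qed.

Variables (eye : pred L) (l r base : L -> L).
Hypothesis F : frame eye l r base.

Local Notation t e := (l (base e) `|` r (base e))%O.

(** Were the join an eye, [x] and [y] would be strictly below it, hence below its base, and so would
    their join. *)
Lemma noneye_join x y : ~~ eye x -> ~~ eye y -> ~~ eye (x `|` y)%O.
Proof.
move=> nx ny; apply/negP => exy; have [bxy _] := frame_base F exy.
have lb z : (z <= x `|` y)%O -> ~~ eye z -> (z <= base (x `|` y))%O.
  move=> zxy nz; apply: (frame_below F exy); rewrite lt_neqAle zxy andbT.
  by apply: contraNneq nz => ->.
have : (x `|` y <= base (x `|` y))%O by rewrite leUx !lb ?leUl ?leUr.
by rewrite (lt_geF (covb_lt bxy)).
Qed.

Lemma noneye_bot bt : (forall y, (bt <= y)%O) -> ~~ eye bt.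
Proof. by move=> H; apply/negP => /(frame_base F)[/covb_lt/lt_geF]; rewrite H. Qed.

Lemma frame_lr_le a : (a <= l a)%O /\ (a <= r a)%O.
Proof.
have [/existsP[y ay]|/existsPn /(frame_max F)[-> ->]//] := boolP [exists y, (a < y)%O].
have [[/covb_lt/ltW-> _] [/covb_lt/ltW-> _]] := (frame_l F ay, frame_r F ay); split=> //.
Qed.

Lemma base_l e : eye e -> covb (base e) (l (base e)) /\ ~~ eye (l (base e)).
Proof. by case/(frame_base F) => /covb_lt/(frame_l F). Qed.

Lemma base_r e : eye e -> covb (base e) (r (base e)) /\ ~~ eye (r (base e)).
Proof. by case/(frame_base F) => /covb_lt/(frame_r F). Qed.

Local Open Scope R_scope.

Variable h : L -> R.
Hypothesis hpoly : polymatroid h.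

Lemma poly_ge0 x : 0 <= h x. Proof. by case: hpoly. Qed.
Lemma poly_mono x y : (x <= y)%O -> h x <= h y. Proof. by case: hpoly => _ [+ _]; apply. Qed.

Lemma poly_sub a x y : (a <= x)%O -> (a <= y)%O -> h (x `|` y)%O + h a <= h x + h y.
Proof.
move=> ax ay; have : h a <= h (x `&` y)%O by apply: poly_mono; rewrite lexI ax.
by case: hpoly => _ [_ /(_ x y)]; lra.
Qed.

(** When [l a = r a] this is the increment [h (l a) - h a], and at the top it is 0. *)
Definition weight a := h (l a) + h (r a) - h a - h (l a `|` r a)%O.

Lemma weight_ge0 a : 0 <= weight a.
Proof. by have [al ar] := frame_lr_le a; rewrite /weight; have := poly_sub al ar; lra. Qed.

(* By downward induction: among the non-eyes, the strict upper bounds of [x] are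
   those of [l x] or [r x], and inclusion-exclusion applies. *)
Lemma weight_up tp x : (forall y, (y <= tp)%O) -> ~~ eye x ->
  \big[Rplus/0]_(a | ~~ eye a && (x <= a)%O) weight a = h tp - h x.
Proof.
move=> tpP; have [n] := ubnP #|[set z | (x <= z)%O]|; elim: n x => // n IH x ltn nx.
have [->|neq] := eqVneq x tp.
  rewrite big1 => [|a /andP[_ tpa]]; first by lra.
  have -> : a = tp by apply/le_anti; rewrite tpP.
  have [|El Er] := @frame_max _ _ _ _ _ _ F tp; first by move=> y; rewrite le_gtF.
  by rewrite /weight El Er joinxx; lra.
have xtp : (x < tp)%O by rewrite lt_neqAle neq tpP.
have [cl nl] := frame_l F xtp; have [cr nr] := frame_r F xtp.
have IH' y : (x < y)%O -> ~~ eye y ->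
    \big[Rplus/0]_(a | ~~ eye a && (y <= a)%O) weight a = h tp - h y.
  move=> xy; apply: IH; move: ltn; rewrite ltnS; apply: leq_trans; apply: proper_card.
  apply/properP; split; last by exists x; rewrite !inE ?lexx ?(lt_geF xy).
  by apply/subsetP => z; rewrite !inE; apply: le_trans; apply: ltW.
have lx := covb_lt cl; have rx := covb_lt cr.
have jx : (x < l x `|` r x)%O by apply: (lt_le_trans lx); rewrite leUl.
have step a : ~~ eye a -> INR (x <= a)%O * weight a =
    INR (a == x) * weight a + INR (l x <= a)%O * weight a + INR (r x <= a)%O * weight a
    - INR (l x `|` r x <= a)%O * weight a.
  move=> na; rewrite leUx; have [->|ax] := eqVneq a x.
    by rewrite lexx (lt_geF lx) (lt_geF rx) /=; lra.
  have [xa|nxa] := boolP (x <= a)%O.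
    have xa' : (x < a)%O by rewrite lt_neqAle xa eq_sym ax.
    by have := frame_above F xa' na; case: (l x <= a)%O; case: (r x <= a)%O => //= _; lra.
  rewrite (negPf (contraNN (le_trans (ltW lx)) nxa)).
  by rewrite (negPf (contraNN (le_trans (ltW rx)) nxa)) /=; lra.
have push (P : pred L) : \big[Rplus/0]_(a | ~~ eye a && P a) weight a =
    \big[Rplus/0]_(a | ~~ eye a) (INR (P a) * weight a).
  rewrite rsum_indic [RHS]rsum_indic; apply: eq_bigr => a _.
  by case: (eye a); case: (P a); rewrite /=; lra.
rewrite push (eq_bigr _ step) rsum_sub !big_split -!push !IH' ?noneye_join //.
rewrite (big_pred1 x) => [|a]; last first.
  by rewrite /=; have [->|] := eqVneq a x; rewrite ?nx ?andbF.
by rewrite /weight /=; lra.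
Qed.

(** * Coordinates with integer multiplicities *)

Section Coordinates.

Variables (tp bt : L).
Hypotheses (tpP : forall y, (y <= tp)%O) (btP : forall y, (bt <= y)%O).

(* [None] carries the constant [h bt], which a polymatroid need not vanish on. *)
Definition wt (o : option L) := if o is Some a then weight a else h bt.
(** Indexing by non-containment turns joins of lattice elements into unions of coordinate sets. *)
Definition active x (o : option L) := if o is Some a then ~~ eye a && ~~ (x <= a)%O else true.

Lemma wt_ge0 o : 0 <= wt o.
Proof. by case: o => [a|]; [exact: weight_ge0|exact: poly_ge0]. Qed.

Lemma active_join x y o : active (x `|` y)%O o = active x o || active y o.
Proof. by case: o => //= a; rewrite leUx negb_and andb_orr. Qed.

Lemma active_mono x y o : (x <= y)%O -> active x o -> active y o.
Proof. by move=> xy; rewrite -(join_r xy) active_join => ->. Qed.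

(** Subtracting [weight_up] at [x] from [weight_up] at [bt] gives [h x - h bt] as the total weight
    of the non-eyes that are not above [x]; [None] supplies [h bt]. *)
Lemma poly_wt x : ~~ eye x -> h x = \big[Rplus/0]_(o | active x o) wt o.
Proof.
move=> nx.
have -> : \big[Rplus/0]_(o | active x o) wt o =
    h bt + \big[Rplus/0]_(a | ~~ eye a && ~~ (x <= a)%O) weight a.
  rewrite (bigD1 None) //=; congr (_ + _).
  rewrite (reindex_omap Some (fun o => o)) /=; last by case.
  by apply: eq_bigl => a; rewrite eqxx andbT andbT.
have := weight_up tpP (noneye_bot btP); rewrite (bigID (fun a => (x <= a)%O)) /=.
have -> : \big[Rplus/0]_(a | (~~ eye a && (bt <= a)%O) && (x <= a)%O) weight a = h tp - h x.
  by rewrite -weight_up //; apply: eq_bigl => a; rewrite btP andbT.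
have -> : \big[Rplus/0]_(a | (~~ eye a && (bt <= a)%O) && ~~ (x <= a)%O) weight a =
    \big[Rplus/0]_(a | ~~ eye a && ~~ (x <= a)%O) weight a.
  by apply: eq_bigl => a; rewrite btP andbT.
by move=> /=; lra.
Qed.

Variable n : nat.

Definition mult o := rfloor (INR n * wt o).
Definition cnt x := (\sum_(o | active x o) mult o)%N.
(** Bounds the total rounding loss in [cnt], at most one unit per coordinate. *)
Definition slack := #|{: option L}|.
(** Number of dimensions that the eye loses against its top. Lowering it by [slack] keeps the
    submodular inequalities valid for the rounded values. *)
Definition deficit e := (rfloor (INR n * (h (t e) - h e)) - slack)%N.

Lemma cnt_bounds x : ~~ eye x -> INR n * h x - INR slack <= INR (cnt x) <= INR n * h x.
Proof.
move=> nx; have n0 := pos_INR n.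
have m0 o : 0 <= INR n * wt o by apply: Rmult_le_pos => //; exact: wt_ge0.
have E : INR n * h x = \big[Rplus/0]_(o | active x o) (INR n * wt o).
  by rewrite (poly_wt nx) big_distrr.
rewrite /cnt rsum_nat E; split; last first.
  by apply: rsum_le => o _; have := rfloorP (m0 o); rewrite /mult; lra.
have : \big[Rplus/0]_(o | active x o) (INR n * wt o - INR (mult o)) <= INR slack.
  have -> : INR slack = \big[Rplus/0]_(o in {: option L}) 1 by rewrite rsum_const Rmult_1_r.
  apply: Rle_trans (rsum_subset (A := active x) _ _) => //; last by move=> *; lra.
  by apply: rsum_le => o _; have := rfloorP (m0 o); rewrite /mult; lra.
by rewrite rsum_sub; lra.
Qed.

Lemma cnt_mono x y : (x <= y)%O -> (cnt x <= cnt y)%N.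
Proof.
move=> xy; rewrite /cnt big_mkcond [leqRHS]big_mkcond; apply: leq_sum => o _.
by case: ifP => // /(active_mono xy) ->.
Qed.

Lemma deficit_bound e : eye e ->
  INR n * (h (t e) - h e) - INR slack - 1 <= INR (deficit e) /\
  (deficit e = 0%N \/ INR (deficit e) <= INR n * (h (t e) - h e) - INR slack).
Proof.
move=> ee; have [et _ _ _] := frame_top F ee; have mt := poly_mono (ltW et).
have n0 := pos_INR n.
have := @rfloorP (INR n * (h (t e) - h e)).
rewrite /deficit; move: (rfloor _) => k /(_ _)[|lo hi]; first by apply: Rmult_le_pos; lra.
have [le|lt] := leqP k slack.
  have /le_INR := elimT ssrnat.leP le; move: le; rewrite -subn_eq0 => /eqP -> /=.
  by split; [lra|left].
by rewrite minus_INR; [split; [lra|right; lra]|apply/ssrnat.leP/ltnW].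
Qed.

(** Submodularity of [h] on [e] and [b] over [base e], multiplied by [n]: the rounding loss of
    [cnt b] is paid by the [slack] removed from the deficit, and a truncated deficit leaves only
    monotonicity. *)
Lemma deficit_le e b : eye e -> ~~ eye b -> (base e <= b)%O -> (e `|` b)%O = t e ->
  (deficit e + cnt (base e) <= cnt b)%N.
Proof.
move=> ee nb ab eb; have [_ [->|hi]] := deficit_bound ee; first by rewrite cnt_mono.
have [ce na] := frame_base F ee.
apply/ssrnat.leP/INR_le; rewrite plus_INR.
have := cnt_bounds nb; have := cnt_bounds na; have n0 := pos_INR n.
have := poly_sub (ltW (covb_lt ce)) ab; rewrite eb => sub.
have : INR n * (h (t e) - h e) <= INR n * (h b - h (base e)).
  by apply: Rmult_le_compat_l; lra.
lra.
Qed.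

(** Submodularity on the two eyes, whose join is [t e]. If one deficit is truncated to zero,
    [deficit_le] for the other suffices. *)
Lemma deficit_le2 e e' : eye e -> eye e' -> base e = base e' -> e != e' ->
  (deficit e + deficit e' + cnt (base e) <= cnt (t e))%N.
Proof.
move=> ee ee' E neq; have et := frame_eyes F ee ee' E neq.
have [[_ nl] [_ nr]] := (base_l ee, base_r ee).
have nt : ~~ eye (t e) by exact: noneye_join.
have le_t x : (x <= t e)%O -> (cnt x <= cnt (t e))%N by exact: cnt_mono.
have [_ _ el er] := frame_top F ee; have [_ _ el' _] := frame_top F ee'.
have [_ D] := deficit_bound ee; have [_ D'] := deficit_bound ee'.
have lel := (frame_lr_le (base e)).1.
have De := deficit_le ee nl lel el.
have De' : (deficit e' + cnt (base e) <= cnt (l (base e)))%N.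
  by move: ee' nl lel el'; rewrite E; exact: deficit_le.
case: D => [->|D]; first by apply: leq_trans De' (le_t _ (leUl _ _)).
case: D' => [->|D']; first by rewrite addn0; apply: leq_trans De (le_t _ (leUl _ _)).
have [ce na] := frame_base F ee; have [ce' _] := frame_base F ee'.
rewrite -E in ce' D'; apply/ssrnat.leP/INR_le; rewrite !plus_INR.
have := cnt_bounds nt; have := cnt_bounds na; have n0 := pos_INR n; have s0 := pos_INR slack.
have := poly_sub (ltW (covb_lt ce)) (ltW (covb_lt ce')); rewrite et => sub.
have : INR n * (h (t e) - h e) + INR n * (h (t e) - h e') <= INR n * (h (t e) - h (base e)).
  by rewrite -Rmult_plus_distr_l; apply: Rmult_le_compat_l; lra.
lra.
Qed.

Definition target x := if eye x then (cnt (t x) - deficit x)%N else cnt x.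

(** The rounding of [cnt] costs at most [slack], that of [deficit] at most [slack] plus one. *)
Lemma target_bound x : Rabs (INR (target x) - INR n * h x) <= 2 * INR slack + 1.
Proof.
rewrite /target; have s0 := pos_INR slack; case: ifP => [ex|/negbT nx]; last first.
  by apply: Rabs_le; have := cnt_bounds nx; lra.
have [_ nl] := base_l ex; have [xt nt el _] := frame_top F ex.
have le : (deficit x <= cnt (t x))%N.
  apply: leq_trans (cnt_mono (leUl _ _)); apply: leq_trans (deficit_le ex nl _ el).
    exact: leq_addr.
  exact: (frame_lr_le _).1.
have n0 := pos_INR n.
have H := poly_mono (ltW xt); have := cnt_bounds nt; have [lo hi] := deficit_bound ex.
have up : INR (deficit x) <= INR n * (h (t x) - h x).
  by case: hi => [->|]; [apply: Rmult_le_pos; lra|lra].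
rewrite minus_INR; last exact/ssrnat.leP.
by move=> B; apply: Rabs_le; lra.
Qed.

End Coordinates.

End Weights.

(** * Subspaces from polynomial residues *)

HB.instance Definition _ (I : finType) (V : finZmodType) := GRing.Zmodule.on {ffun I -> V}.

Section Subgroups.

Import GRing.Theory.
Local Open Scope ring_scope.

Variable V : finZmodType.

(** Addition is a bijection from the product of two complementary subgroups onto [V]; being closed
    under subtraction is all that is used of a subgroup. *)
Lemma card_complement (K C : {set V}) :
  {in K &, forall u v, u - v \in K} -> {in C &, forall u v, u - v \in C} ->
  (forall v, v \in K -> v \in C -> v = 0) ->
  (forall v, exists2 c, c \in C & v - c \in K) -> (#|K| * #|C|)%N = #|V|.
Proof.
move=> KB CB KC0 KC; rewrite -cardsX -cardsT.
rewrite -(card_in_imset (f := fun u : V * V => u.1 + u.2) (D := mem (setX K C))).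
  apply: eq_card => v; rewrite [RHS]inE; apply/imsetP.
  by have [c Cc Kvc] := KC v; exists (v - c, c); rewrite ?inE /= ?Kvc ?subrK.
move=> [k c] [k' c']; rewrite !inE /= => /andP[Kk Cc] /andP[Kk' Cc'] E.
have E' : k - k' = c' - c.
  by apply/eqP; rewrite subr_eq addrAC eq_sym subr_eq E addrC.
have kk : k - k' = 0 by apply: KC0; [exact: KB|rewrite E'; exact: CB].
have -> : k = k' by apply/eqP; rewrite -subr_eq0 kk.
by have -> : c = c' by apply/esym/eqP; rewrite -subr_eq0 -E' kk.
Qed.

End Subgroups.

Section HermiteCode.

Import GRing.Theory.
Local Open Scope ring_scope.

Variables (F : finFieldType) (I : finType).
Implicit Types (A S : {set I}) (u v : {ffun I -> F}).

(** Kernel of the restriction to [S]: knowing the coset of a vector modulo [vanish S] is knowing its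
    coordinates in [S]. *)
Definition vanish S : {set {ffun I -> F}} := [set v : {ffun I -> F} | [forall i in S, v i == 0]].
Definition supported S : {set {ffun I -> F}} := vanish (~: S).

Lemma vanishP S v : reflect {in S, forall i, v i = 0} (v \in vanish S).
Proof. by rewrite inE; apply: (iffP forall_inP) => H i iS; apply/eqP; rewrite H. Qed.

Lemma vanishB S : {in vanish S &, forall u v, u - v \in vanish S}.
Proof.
move=> u v /vanishP u0 /vanishP v0; apply/vanishP => i iS.
by rewrite !ffunE u0 // v0 // subrr.
Qed.

Lemma vanish0 S : 0 \in vanish S.
Proof. by apply/vanishP => i _; rewrite ffunE. Qed.

Lemma vanishU S S' : vanish (S :|: S') = vanish S :&: vanish S'.
Proof.
apply/setP => v; rewrite in_setI; apply/vanishP/andP => [H|[/vanishP H /vanishP H'] i].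
  by split; apply/vanishP => i iS; rewrite H // inE iS ?orbT.
by rewrite inE => /orP[/H|/H'].
Qed.

Lemma vanishS S S' : S \subset S' -> vanish S' \subset vanish S.
Proof. by move/setUidPr <-; rewrite vanishU subsetIl. Qed.

Lemma card_supported S : #|supported S| = (#|F| ^ #|S|)%N.
Proof.
rewrite -(card_pffun_on 0 (mem S) predT).
apply: eq_card => v; apply/vanishP/pffun_onP => [H|[/subsetP H _] i].
  split=> //; apply/subsetP => i; rewrite inE /= => /eqP vi.
  by apply/negPn/negP => iS; apply: vi; apply: H; rewrite inE.
by rewrite inE => iS; apply/eqP/negPn/negP => vi; case/negP: iS; apply: H.
Qed.

Lemma card_vanish S : (#|vanish S| * #|F| ^ #|S|)%N = #|{ffun I -> F}|.
Proof.
rewrite -card_supported; apply: (@card_complement {ffun I -> F}); [exact: vanishB|exact: vanishB|..].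
  move=> v /vanishP v0 /vanishP v1; apply/ffunP => i; rewrite ffunE.
  by have [/v0 //|iS] := boolP (i \in S); apply: v1; rewrite inE.
move=> v; exists [ffun i => if i \in S then v i else 0].
  by apply/vanishP => i; rewrite inE ffunE => /negPf ->.
by apply/vanishP => i iS; rewrite !ffunE iS subrr.
Qed.

Variables (A Lf Rt : {set I}).
Hypothesis AL : A \subset Lf.
Hypothesis AR : A \subset Rt.

Definition positions : seq I :=
  enum (Rt :\: Lf) ++ enum ((Lf :&: Rt) :\: A) ++ enum (Lf :\: Rt).

Definition coords v : {poly F} := Poly [seq v i | i <- positions].

(* The coordinates of [v] in [(Lf :|: Rt) :\: A] are read as the coefficients of a
   polynomial, those of [Rt] in low and those of [Lf] in high degrees. *)
Definition code (c : F) (f : nat) : {set {ffun I -> F}} :=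
  [set v in vanish A | ('X - c%:P) ^+ f %| coords v].

Lemma in_code c f v :
  (v \in code c f) = (v \in vanish A) && (('X - c%:P) ^+ f %| coords v).
Proof. by rewrite /code in_set. Qed.

Local Notation s := positions.

Lemma mem_positions i : (i \in s) = (i \in (Lf :|: Rt) :\: A).
Proof.
rewrite !mem_cat !mem_enum !inE.
have /implyP := subsetP AL i; have /implyP := subsetP AR i.
by case: (i \in A); case: (i \in Lf); case: (i \in Rt).
Qed.

Lemma positions_uniq : uniq s.
Proof.
rewrite !cat_uniq !enum_uniq /= andbT -!all_predC !all_cat.
have dis (B C : {set I}) : (forall i, i \in C -> i \notin B) ->
    all [predC enum B] (enum C).
  by move=> H; apply/allP => i; rewrite !mem_enum inE mem_enum => /H.
rewrite !dis //; by move=> i; rewrite !inE; case: (i \in Lf); case: (i \in Rt); rewrite ?andbF.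
Qed.

Lemma size_positions : size s = #|(Lf :|: Rt) :\: A|.
Proof. by rewrite -(card_uniqP positions_uniq); apply: eq_card => i; rewrite mem_positions. Qed.

Lemma coef_coords v i0 j : (j < size s)%N -> (coords v)`_j = v (nth i0 s j).
Proof. by move=> js; rewrite coef_Poly (nth_map i0). Qed.

Lemma size_coords v : (size (coords v) <= size s)%N.
Proof. by rewrite (leq_trans (size_Poly _)) // size_map. Qed.

Lemma coordsB u v : coords (u - v) = coords u - coords v.
Proof.
apply/polyP => j; rewrite coefB !coef_Poly; have [js|sj] := ltnP j (size s).
  have i0 : I by case: (s) js => // i.
  by rewrite !(nth_map i0) // !ffunE.
by rewrite !nth_default ?size_map // subrr.
Qed.

Lemma coords0 v : coords v = 0 -> v \in vanish ((Lf :|: Rt) :\: A).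
Proof.
move=> v0; apply/vanishP => i; rewrite -mem_positions => iS.
by rewrite -[i in v i](nth_index i iS) -coef_coords ?index_mem // v0 coef0.
Qed.

Lemma coords_vanish v : v \in vanish ((Lf :|: Rt) :\: A) -> coords v = 0.
Proof.
move/vanishP => v0; apply/polyP => j; rewrite coef0 coef_Poly.
have [js|sj] := ltnP j (size s); last by rewrite nth_default ?size_map.
have i0 : I by case: (s) js => // i.
by rewrite (nth_map i0) // v0 // -mem_positions mem_nth.
Qed.

Lemma codeB c f : {in code c f &, forall u v, u - v \in code c f}.
Proof.
move=> u v; rewrite !in_code => /andP[uA du] /andP[vA dv].
by rewrite vanishB //= coordsB dvdp_sub.
Qed.

Lemma code_vanish c f : code c f \subset vanish A.
Proof. by apply/subsetP => v; rewrite in_code => /andP[]. Qed.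

Lemma vanish_code c f : vanish (Lf :|: Rt) \subset code c f.
Proof.
apply/subsetP => v vU; rewrite in_code; apply/andP; split.
  by apply: subsetP v vU; apply: vanishS; rewrite subsetU ?AL.
rewrite coords_vanish ?dvdp0 //; apply: subsetP v vU; apply: vanishS; exact: subsetDl.
Qed.

Lemma code_zero c f v : v \in code c f -> coords v = 0 -> v \in vanish (Lf :|: Rt).
Proof.
move=> /(subsetP (code_vanish c f)) vA /coords0 v0.
have -> : Lf :|: Rt = A :|: ((Lf :|: Rt) :\: A).
  apply/setP => i; rewrite !inE; have := subsetP AL i.
  by case: (i \in A) => //= /(_ isT) ->.
by rewrite vanishU in_setI vA v0.
Qed.

Lemma size_XsubC_exp c f : size (('X - c%:P) ^+ f : {poly F}) = f.+1.
Proof. by rewrite size_exp_XsubC. Qed.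

Lemma cards_positions : [/\ size s = (#|Rt :\: Lf| + #|Lf :\: A|)%N,
  size s = (#|Rt :\: A| + #|Lf :\: Rt|)%N & #|Rt :\: A| = (#|Rt :\: Lf| + #|(Lf :&: Rt) :\: A|)%N].
Proof.
have dU (B C D : {set I}) : B :|: C = D -> B :&: C = set0 -> #|D| = (#|B| + #|C|)%N.
  by move=> <- dis; rewrite cardsU dis cards0 subn0.
rewrite size_positions; split; apply: dU; apply/setP => i; rewrite !inE;
  have /implyP := subsetP AL i; have /implyP := subsetP AR i;
  by case: (i \in A); case: (i \in Lf); case: (i \in Rt).
Qed.

(** Only the coefficients from [Rt :\: Lf], which come first in [positions], can be nonzero, so the
    polynomial has degree below [f] while being a multiple of a polynomial of degree [f]. *)
Lemma code_left c f v : (#|Rt :\: Lf| <= f)%N -> v \in code c f -> v \in vanish Lf ->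
  v \in vanish (Lf :|: Rt).
Proof.
move=> le vc /vanishP v0; apply: (code_zero vc).
apply/eqP/negPn/negP => nz; move: (vc); rewrite in_code => /andP[_ /(dvdp_leq nz)].
rewrite size_XsubC_exp ltnNge => /negP[]; apply: leq_trans le.
apply/leq_sizeP => j lej; rewrite coef_Poly.
have [js|sj] := ltnP j (size s); last by rewrite nth_default ?size_map.
have i0 : I by case: (s) js => // i.
rewrite (nth_map i0) // v0 // /positions nth_cat -cardE ltnNge lej /=.
have : nth i0 (enum ((Lf :&: Rt) :\: A) ++ enum (Lf :\: Rt)) (j - #|Rt :\: Lf|)
    \in enum ((Lf :&: Rt) :\: A) ++ enum (Lf :\: Rt).
  by rewrite mem_nth // ltn_subLR //; move: js; rewrite /positions size_cat -cardE.
by rewrite mem_cat !mem_enum !inE => /orP[/and3P[]|/andP[]].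
Qed.

(** Vanishing on [Rt] makes the polynomial divisible by a power of ['X], which is coprime to the
    power of ['X - c%:P] because [c != 0]. The product has too large a degree. *)
Lemma code_right c f v : c != 0 -> (size s <= #|Rt :\: A| + f)%N ->
  v \in code c f -> v \in vanish Rt -> v \in vanish (Lf :|: Rt).
Proof.
move=> c0 le vc /vanishP v0; apply: (code_zero vc).
apply/eqP/negPn/negP => nz; move: (vc); rewrite in_code => /andP[_ dv].
have dX : 'X^#|Rt :\: A| %| coords v.
  apply/dvdpP; exists (drop_poly #|Rt :\: A| (coords v)).
  rewrite -[LHS](poly_take_drop #|Rt :\: A|) -[RHS]add0r; congr (_ + _).
  apply/polyP => j; rewrite coef_take_poly coef0; case: ifP => // jR.
  have js : (j < size s)%N by have [_ -> _] := cards_positions; rewrite ltn_addr.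
  have i0 : I by case: (s) js => // i.
  rewrite (coef_coords _ i0) // v0 //.
  have -> : nth i0 s j = nth i0 (enum (Rt :\: Lf) ++ enum ((Lf :&: Rt) :\: A)) j.
    rewrite /positions catA [LHS]nth_cat size_cat -!cardE.
    by have [_ _ <-] := cards_positions; rewrite jR.
  have : nth i0 (enum (Rt :\: Lf) ++ enum ((Lf :&: Rt) :\: A)) j
      \in enum (Rt :\: Lf) ++ enum ((Lf :&: Rt) :\: A).
    by rewrite mem_nth // size_cat -!cardE; have [_ _ <-] := cards_positions.
  by rewrite mem_cat !mem_enum !inE => /orP[/andP[]|/and3P[]].
have cop : coprimep ('X^#|Rt :\: A|) (('X - c%:P) ^+ f).
  apply: coprimep_expl; apply: coprimep_expr.
  by rewrite coprimep_XsubC rootX.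
have := dvdp_leq nz; move/(_ ('X^#|Rt :\: A| * ('X - c%:P) ^+ f)).
rewrite Gauss_dvdp // dX dv => /(_ isT).
rewrite size_mul -?size_poly_eq0 ?size_polyXn ?size_XsubC_exp // addSn addnS /= ltnNge.
by move=> /negP[]; exact: leq_trans (size_coords v) le.
Qed.

(** Powers at distinct nodes are coprime, so their product, of degree [f + f'], divides the
    polynomial. *)
Lemma code_meet c c' f f' v : c != c' -> (size s <= f + f')%N ->
  v \in code c f -> v \in code c' f' -> v \in vanish (Lf :|: Rt).
Proof.
move=> cc le vc vc'; apply: (code_zero vc).
apply/eqP/negPn/negP => nz; move: (vc) (vc'); rewrite !in_code => /andP[_ dv] /andP[_ dv'].
have cop : coprimep (('X - c%:P) ^+ f) (('X - c'%:P) ^+ f').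
  by apply: coprimep_expl; apply: coprimep_expr; rewrite coprimep_XsubC root_XsubC eq_sym.
have := dvdp_leq nz; move/(_ (('X - c%:P) ^+ f * ('X - c'%:P) ^+ f')).
rewrite Gauss_dvdp // dv dv' => /(_ isT).
rewrite size_mul -?size_poly_eq0 ?size_XsubC_exp // addSn addnS /= ltnNge => /negP[].
exact: leq_trans (size_coords v) le.
Qed.

(** Division with remainder: the vectors supported on [A] and the first [f] positions form a
    complement of the code, the remainder being written on those positions. *)
Lemma card_code c f : (f <= size s)%N ->
  (#|code c f| * #|F| ^ (#|A| + f))%N = #|{ffun I -> F}|.
Proof.
move=> fs; pose B := A :|: [set i in take f s].
have tA i : i \in s -> i \notin A by rewrite mem_positions inE => /andP[].
have cB : #|B| = (#|A| + f)%N.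
  rewrite cardsU (_ : _ :&: _ = set0) ?cards0 ?subn0; last first.
    apply/setP => i; rewrite !inE; apply/negP => /andP[iA /mem_take/tA]; by rewrite iA.
  congr (_ + _)%N; rewrite cardsE; have /card_uniqP -> := take_uniq f positions_uniq.
  by rewrite size_take_min; apply/minn_idPl.
rewrite -cB -card_supported.
have szr v : (size ((coords v %% ('X - c%:P) ^+ f)%R) <= f)%N.
  have nz : ('X - c%:P) ^+ f != 0 by rewrite -size_poly_eq0 size_XsubC_exp.
  by have := ltn_modp (coords v) (('X - c%:P) ^+ f); rewrite nz size_XsubC_exp ltnS => ->.
have take_nth i0 j : (j < size s)%N -> (nth i0 s j \in take f s) = (j < f)%N.
  move=> js; apply/idP/idP; last first.
    by move=> jf; rewrite -(nth_take _ jf) mem_nth // size_take_min leq_min jf js.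
  by rewrite in_take ?mem_nth // index_uniq ?positions_uniq.
apply: (@card_complement {ffun I -> F}); [exact: codeB|exact: vanishB|..].
  move=> v vc /vanishP vB.
  have /vanishP v0 : v \in vanish (Lf :|: Rt).
    apply: (code_zero vc); apply/eqP/negPn/negP => nz.
    move: (vc); rewrite in_code => /andP[_ /(dvdp_leq nz)].
    rewrite size_XsubC_exp ltnNge => /negP[]; apply/leq_sizeP => j lej.
    have [js|sj] := ltnP j (size s); last by rewrite coef_Poly nth_default ?size_map.
    have i0 : I by case: (s) js => // i.
    rewrite (coef_coords _ i0) // vB // !inE negb_or tA ?mem_nth //=.
    by rewrite take_nth // -leqNgt.
  apply/ffunP => i; rewrite ffunE; have [/v0//|iU] := boolP (i \in Lf :|: Rt).
  apply: vB; rewrite !inE negb_or; apply/andP; split.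
    by apply: contraNN iU => iA; rewrite inE (subsetP AL).
  by apply: contraNN iU => /mem_take; rewrite mem_positions inE => /andP[].
move=> v; pose rem := coords v %% ('X - c%:P) ^+ f.
pose w := [ffun i => if i \in A then v i else if i \in take f s then rem`_(index i s) else 0].
have wrem : coords w = rem.
  apply/polyP => j; have [js|sj] := ltnP j (size s).
    have i0 : I by case: (s) js => // i.
    rewrite (coef_coords _ i0) // ffunE (negPf (tA _ (mem_nth _ js))) take_nth //.
    rewrite index_uniq ?positions_uniq //; case: ltnP => // fj.
    by rewrite nth_default // (leq_trans (szr v)).
  by rewrite coef_Poly !nth_default ?size_map // (leq_trans (szr v)) // (leq_trans fs).
exists w.
  apply/vanishP => i; rewrite !inE negb_or ffunE => /andP[/negPf -> /negPf ->] //.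
rewrite in_code coordsB wrem; apply/andP; split.
  by apply/vanishP => i iA; rewrite !ffunE iA subrr.
rewrite {1}(divp_eq (coords v) (('X - c%:P) ^+ f)) addrK; exact: dvdp_mull.
Qed.

End HermiteCode.

(** * Linear representation *)

Section Representation.

Variables (d : Order.disp_t) (L : finLatticeType d).
Implicit Types (a b e x y z : L).
Variables (eye : pred L) (l r base : L -> L).
Hypothesis F : frame eye l r base.
Variables (h : L -> R) (tp bt : L) (n p : nat).
Hypotheses (hpoly : polymatroid h).
Hypotheses (tpP : forall y, (y <= tp)%O) (btP : forall y, (bt <= y)%O).
Hypotheses (p_pr : prime p) (Lp : (#|L| < p)%N).

Local Notation t e := (l (base e) `|` r (base e))%O.
Local Notation mult := (mult l r h bt n).
Local Notation active := (active eye).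
Local Notation cnt := (cnt eye l r h bt n).
Local Notation deficit := (deficit l r base h n).
Local Notation target := (target eye l r base h bt n).

(** A bound common to all multiplicities lets the coordinates live in a product type, from which
    [index_set] selects the copies in use. *)
Definition copies := (\max_o mult o).+1.
Definition index_set x : {set option L * 'I_copies} :=
  [set i : option L * 'I_copies | active x i.1 && (i.2 < mult i.1)%N].
Local Notation S := index_set.

Lemma index_set_join x y : S (x `|` y)%O = S x :|: S y.
Proof. by apply/setP => i; rewrite !inE active_join andb_orl. Qed.

Lemma index_set_mono x y : (x <= y)%O -> S x \subset S y.
Proof. by move=> xy; rewrite -(join_r xy) index_set_join subsetUl. Qed.

Lemma card_index_set x : #|S x| = cnt x.
Proof.
rewrite -sum1_card (eq_bigl (fun i : option L * 'I_copies => active x i.1 && (i.2 < mult i.1)%N)); last first.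
  by move=> i; rewrite inE.
rewrite -(pair_big_dep (active x) (fun o (j : 'I_copies) => (j < mult o)%N) (fun _ _ => 1%N)).
apply: eq_bigr => o _.
have le : (mult o <= copies)%N by apply: leqW; apply: (leq_bigmax (F := mult)).
by rewrite (big_ord_narrow le) sum1_card card_ord.
Qed.

Lemma card_diff_index_set x y : (x <= y)%O -> #|S y :\: S x| = (cnt y - cnt x)%N.
Proof. by move=> xy; rewrite cardsDS ?index_set_mono // !card_index_set. Qed.

(** The shift by one avoids 0, as [code_right] demands, and [#|L| < p] keeps the nodes distinct. *)
Definition node x : 'F_p := ((enum_rank x).+1%:R)%R.

Lemma val_node x : node x = (enum_rank x).+1 :> nat.
Proof. by rewrite /node val_Fp_nat // modn_small // (leq_ltn_trans (ltn_ord _) Lp). Qed.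

Lemma node_neq0 x : node x != 0%R.
Proof. by apply/eqP => /(congr1 val) /=; rewrite val_node. Qed.

Lemma node_inj : injective node.
Proof.
move=> x y /(congr1 val) /=; rewrite !val_node => -[] E.
by apply: enum_rank_inj; apply: val_inj.
Qed.

(** The variable at [x] will be the coset of a random vector modulo [kernel x]. For an eye the
    exponent is what remains of [target x] after the coordinates of the base. *)
Definition kernel x : {set {ffun option L * 'I_copies -> 'F_p}} :=
  if eye x then code (S (base x)) (S (l (base x))) (S (r (base x))) (node x)
                  (cnt (t x) - cnt (base x) - deficit x)
  else vanish 'F_p (S x).

Lemma kernelB x : {in kernel x &, forall u v, (u - v)%R \in kernel x}.
Proof. by rewrite /kernel; case: ifP => _; [exact: codeB|exact: vanishB]. Qed.

Lemma base_le_l x : S (base x) \subset S (l (base x)).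
Proof. exact/index_set_mono/(frame_lr_le F _).1. Qed.

Lemma base_le_r x : S (base x) \subset S (r (base x)).
Proof. exact/index_set_mono/(frame_lr_le F _).2. Qed.

Lemma vanish_kernel x : vanish 'F_p (S (if eye x then t x else x)) \subset kernel x.
Proof.
rewrite /kernel; case: ifP => // _; rewrite index_set_join.
by apply: vanish_code; [exact: base_le_l|exact: base_le_r].
Qed.

Lemma kernel_vanish x : kernel x \subset vanish 'F_p (S (if eye x then base x else x)).
Proof. by rewrite /kernel; case: ifP => // _; exact: code_vanish. Qed.

Lemma kernel0 x : 0%R \in kernel x.
Proof. by apply: (subsetP (vanish_kernel x)); exact: vanish0. Qed.

(** Each kernel is sandwiched between the kernels of non-eyes: base and top for an eye, itself
    otherwise. For [x < y] the upper non-eye of [x] is below the lower one of [y]. *)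
Lemma kernel_mono x y : (x <= y)%O -> kernel y \subset kernel x.
Proof.
have [->//|neq xy] := eqVneq x y; have {neq xy} lt_xy : (x < y)%O by rewrite lt_neqAle neq.
apply: subset_trans (kernel_vanish y) _; apply: subset_trans _ (vanish_kernel x).
apply/vanishS/index_set_mono.
have hi : ((if eye x then t x else x) <= y)%O.
  by case: ifP => [ex|_]; [exact: (frame_over F ex lt_xy)|exact: ltW].
have [ey|//] := boolP (eye y); apply: (frame_below F ey); rewrite lt_neqAle hi andbT.
case: ifP => [ex|/negbT nx]; last by rewrite lt_eqF.
by apply: contraTneq ey => <-; have [] := frame_top F ex.
Qed.

Lemma eye_cnt x : eye x -> [/\ (deficit x + cnt (base x) <= cnt (l (base x)))%N,
  (deficit x + cnt (base x) <= cnt (r (base x)))%N,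
  (cnt (l (base x)) <= cnt (t x))%N & (cnt (r (base x)) <= cnt (t x))%N].
Proof.
move=> ex; have [_ _ el er] := frame_top F ex.
have [[_ nl] [_ nr]] := (base_l F ex, base_r F ex).
split; rewrite ?cnt_mono ?leUl ?leUr //.
  by apply: (deficit_le F hpoly tpP btP) => //; exact: (frame_lr_le F _).1.
by apply: (deficit_le F hpoly tpP btP) => //; exact: (frame_lr_le F _).2.
Qed.

Lemma card_kernel x : (#|kernel x| * p ^ target x)%N =
  #|{: {ffun option L * 'I_copies -> 'F_p}}|.
Proof.
have -> : (p ^ target x = #|'F_p| ^ target x)%N by rewrite card_Fp.
rewrite /kernel /target; case: ifP => [ex|_]; last first.
  by rewrite -card_index_set card_vanish.
have [dl dr lt rt] := eye_cnt ex.
have -> : (cnt (t x) - deficit x)%N =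
    (#|S (base x)| + (cnt (t x) - cnt (base x) - deficit x))%N.
  by rewrite card_index_set; lia.
apply: card_code; rewrite ?base_le_l ?base_le_r //.
rewrite size_positions ?base_le_l ?base_le_r // -index_set_join card_diff_index_set; first by lia.
by apply: le_trans (leUl _ _); exact: (frame_lr_le F _).1.
Qed.

Lemma size_eye_positions x : eye x ->
  size (positions (S (base x)) (S (l (base x))) (S (r (base x)))) =
  (cnt (t x) - cnt (base x))%N.
Proof.
move=> ex; rewrite size_positions ?base_le_l ?base_le_r // -index_set_join.
rewrite card_diff_index_set //.
by apply: le_trans (leUl _ _); exact: (frame_lr_le F _).1.
Qed.

(** The join of [base e] and [y] is a non-eye strictly above [base e], hence above [l (base e)] or
    [r (base e)]. So [v] vanishes on the coordinates of one of them, and [code_left] or [code_right]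
    applies; their size conditions unfold to the two instances of [deficit_le] in [eye_cnt]. *)
Lemma kernel_eye_noneye e y : eye e -> ~~ eye y -> ~~ (e <= y)%O -> ~~ (y <= e)%O ->
  kernel e :&: kernel y \subset vanish 'F_p (S (t e)).
Proof.
move=> ee ny ney nye; apply/subsetP => v /setIP[ve]; rewrite {1}/kernel (negPf ny) => vy.
have [be nb] := frame_base F ee; have [dl dr lt rt] := eye_cnt ee.
have vb : v \in vanish 'F_p (S (base e)).
  by have := subsetP (kernel_vanish e) _ ve; rewrite ee.
have nj : ~~ eye (base e `|` y)%O by rewrite (noneye_join F).
have bj : (base e < base e `|` y)%O.
  rewrite lt_neqAle leUl andbT; apply: contraNneq nye => E.
  by apply: le_trans (ltW (covb_lt be)); rewrite E leUr.
have vj : v \in vanish 'F_p (S (base e `|` y)%O) by rewrite index_set_join vanishU in_setI vb.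
rewrite index_set_join; move: (ve); rewrite /kernel ee => vc.
have c1 : (#|S (l (base e)) :\: S (base e)| = cnt (l (base e)) - cnt (base e))%N.
  by rewrite card_diff_index_set //; exact: (frame_lr_le F _).1.
have c2 : (#|S (r (base e)) :\: S (base e)| = cnt (r (base e)) - cnt (base e))%N.
  by rewrite card_diff_index_set //; exact: (frame_lr_le F _).2.
have sz := size_eye_positions ee.
have [sz1 _ _] := cards_positions (base_le_l e) (base_le_r e).
have [lj|rj] := orP (frame_above F bj nj).
  apply: (code_left (base_le_l e) (base_le_r e) _ vc).
    by move: c1 sz sz1 dl dr lt rt; clear; lia.
  exact: (subsetP (vanishS _ (index_set_mono lj)) _ vj).
apply: (code_right (base_le_l e) (base_le_r e) (node_neq0 e) _ vc).
  by move: c2 sz dl dr lt rt; clear; lia.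
exact: (subsetP (vanishS _ (index_set_mono rj)) _ vj).
Qed.

(** Everything strictly above [e] is above [t e], so [e] can be replaced by [t e] in the join. *)
Lemma kernel_eye_noneye_join e y : eye e -> ~~ eye y -> ~~ (e <= y)%O -> ~~ (y <= e)%O ->
  kernel e :&: kernel y \subset kernel (e `|` y)%O.
Proof.
move=> ee ny ney nye; have [et nt _ _] := frame_top F ee.
have -> : (e `|` y = t e `|` y)%O.
  apply/le_anti; rewrite !leUx !leUr (le_trans (ltW et) (leUl _ _)) !andbT /= -leUx.
  apply: (frame_over F ee); rewrite lt_neqAle leUl andbT; apply: contraNneq nye => ->.
  exact: leUr.
have -> : kernel (t e `|` y)%O = vanish 'F_p (S (t e)) :&: kernel y.
  rewrite /kernel (negPf (noneye_join F nt ny)) (negPf ny).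
  by rewrite (index_set_join (t e)) vanishU.
by rewrite subsetI subsetIr andbT kernel_eye_noneye.
Qed.

(** The size condition of [code_meet] is the inequality [deficit_le2]. *)
Lemma kernel_eyes e e' : eye e -> eye e' -> ~~ (e <= e')%O -> ~~ (e' <= e)%O ->
  base e = base e' -> kernel e :&: kernel e' \subset kernel (e `|` e')%O.
Proof.
move=> ee ee' nle nge E; have neq : e != e' by apply: contraNneq nle => ->.
rewrite (frame_eyes F ee ee' E neq).
have [et nt _ _] := frame_top F ee.
apply/subsetP => v /setIP[ve ve']; rewrite /kernel (negPf nt) index_set_join.
rewrite /kernel ee in ve; rewrite /kernel ee' -E in ve'.
have [dl dr lt rt] := eye_cnt ee; have [dl' _ _ _] := eye_cnt ee'.
have := deficit_le2 F hpoly tpP btP n ee ee' E neq.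
have sz := size_eye_positions ee => D.
apply: (code_meet (base_le_l e) (base_le_r e) _ _ ve ve').
  by apply: contra_neq neq; exact: node_inj.
by move: D sz dl dr lt rt dl'; clear; lia.
Qed.

Lemma kernel_meet x y : kernel x :&: kernel y \subset kernel (x `|` y)%O.
Proof.
have [xy|nxy] := boolP (x <= y)%O; first by rewrite (join_r xy) subsetIr.
have [yx|nyx] := boolP (y <= x)%O; first by rewrite (join_l yx) subsetIl.
have [ex|nx] := boolP (eye x); have [ey|ny] := boolP (eye y).
- (* If [base e'] is not below [e], then [kernel e :&: kernel (base e')] already lies
     in the kernel of the top above [e]; otherwise the two bases coincide. *)
  have key e e' : eye e -> eye e' -> ~~ (e <= e')%O -> ~~ (e' <= e)%O ->
      ~~ (base e' <= e)%O -> kernel e :&: kernel e' \subset kernel (e `|` e')%O.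
    move=> ee ee' nle nge nb; have [be' nbe'] := frame_base F ee'.
    have [et nt _ _] := frame_top F ee.
    have nle' : ~~ (e <= base e')%O.
      by apply: contraNN nle => /le_trans; apply; exact/ltW/covb_lt.
    have sub : kernel e :&: kernel e' \subset kernel (t e) :&: kernel e'.
      have -> : kernel (t e) = vanish 'F_p (S (t e)) by rewrite /kernel (negPf nt).
      rewrite subsetI subsetIr andbT.
      apply: subset_trans (kernel_eye_noneye ee nbe' nle' nb).
      by apply/setIS/kernel_mono/ltW/covb_lt.
    apply: subset_trans sub _.
    have le_j : (e `|` e' <= e' `|` t e)%O by rewrite leUx leUl (le_trans (ltW et) (leUr _ _)).
    apply: subset_trans (kernel_mono le_j); rewrite setIC.
    have [te'|nte'] := boolP (t e <= e')%O.
      by rewrite (le_trans (ltW et) te') in nle.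
    have [e't|ne't] := boolP (e' <= t e)%O; first by rewrite (join_r e't) subsetIr.
    exact: kernel_eye_noneye_join.
  have [byx|] := boolP (base y <= x)%O; last exact: key.
  have [bxy|] := boolP (base x <= y)%O; last first.
    by move=> nb; rewrite joinC setIC; exact: key.
  apply: kernel_eyes => //; apply/le_anti; apply/andP; split.
    apply: (frame_below F ey); rewrite lt_neqAle bxy andbT.
    by apply: contraTneq ey => <-; have [] := frame_base F ex.
  apply: (frame_below F ex); rewrite lt_neqAle byx andbT.
  by apply: contraTneq ex => <-; have [] := frame_base F ey.
- exact: kernel_eye_noneye_join.
- by rewrite joinC setIC; exact: kernel_eye_noneye_join.
by rewrite /kernel (negPf nx) (negPf ny) (negPf (noneye_join F nx ny)) index_set_join vanishU.
Qed.

(** A coset of an intersection determines and is determined by the pair of cosets: this is the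
    functional dependence demanded of entropic functions. *)
Lemma kernel_join x y : kernel (x `|` y)%O = kernel x :&: kernel y.
Proof.
apply/eqP; rewrite eqEsubset kernel_meet andbT subsetI.
by rewrite !kernel_mono ?leUl ?leUr.
Qed.

End Representation.

(** * Entropic approximation *)

Section InfiniteSums.

Local Open Scope R_scope.

Lemma sum_f_R0_big (s : nat -> R) n : sum_f_R0 s n = \big[Rplus/0]_(i < n.+1) s i.
Proof.
by elim: n => [|n IH]; rewrite big_ord_recr /= ?big_ord0 /= ?Rplus_0_l // -IH.
Qed.

Lemma infinite_sum_ext (s s' : nat -> R) l : (forall w, s w = s' w) ->
  infinite_sum s l -> infinite_sum s' l.
Proof.
move=> E H eps /H[N HN]; exists N => n /HN.
by rewrite !sum_f_R0_big (eq_bigr (fun i : 'I_n.+1 => s' i)).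
Qed.

Lemma infinite_sum_finite (s : nat -> R) N : (forall w, (N <= w)%N -> s w = 0) ->
  infinite_sum s (\big[Rplus/0]_(i < N) s i).
Proof.
move=> s0 eps e0; exists N => n /ssrnat.leP Nn.
suff -> : sum_f_R0 s n = \big[Rplus/0]_(i < N) s i by rewrite Rdist_eq.
rewrite sum_f_R0_big -!(big_mkord xpredT s) (big_cat_nat (n := N)) //=; last exact: leqW.
rewrite [X in _ + X]big_nat_cond [X in _ + X]big1 ?Rplus_0_r //.
by move=> i /andP[/andP[Ni _] _]; exact: s0.
Qed.

Variable T : finType.

Definition extend (F : T -> R) (w : nat) :=
  if insub w is Some i then F (@enum_val T predT i) else 0.

Lemma infinite_sum_extend (F : T -> R) : infinite_sum (extend F) (\big[Rplus/0]_t F t).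
Proof.
have -> : \big[Rplus/0]_t F t = \big[Rplus/0]_(i < #|T|) extend F i.
  rewrite (big_enum_val (A := predT)); apply: eq_bigr => i _.
  by rewrite /extend valK.
apply: infinite_sum_finite => w lw; rewrite /extend insubN //.
by rewrite -leqNgt.
Qed.

End InfiniteSums.

(** * Entropic functions from finite probability spaces and groups *)

Section FiniteModels.

Variables (d : Order.disp_t) (L : finLatticeType d).

Local Open Scope R_scope.

(** Outcomes and values are coded by their ranks. Functional dependence is stated through the
    partitions of [W], and entropy as the mean of minus the logarithm of the probability of the
    block. *)
Lemma finite_entropic (W T : finType) (P : W -> R) (Z : L -> W -> T) :
  (forall w, 0 <= P w) -> \big[Rplus/0]_w P w = 1 ->
  (forall x y w w', (Z (x `|` y)%O w == Z (x `|` y)%O w') =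
                    (Z x w == Z x w') && (Z y w == Z y w')) ->
  entropic (fun x => \big[Rplus/0]_w (P w * - ln (\big[Rplus/0]_(w' | Z x w' == Z x w) P w'))).
Proof.
move=> P0 P1 ZJ.
pose rk x w : nat := enum_rank (Z x w).
have rk_eq x w w' : (rk x w == rk x w') = (Z x w == Z x w').
  by rewrite /rk (inj_eq val_inj) (inj_eq enum_rank_inj).
pose X x v : nat := if insub v is Some i then rk x (@enum_val W predT i) else 0%N.
have Xval x v : 0 < extend P v -> exists2 w, X x v = rk x w & forall y, X y v = rk y w.
  by rewrite /extend /X; case: insubP => [i _ _ _|_ /Rlt_irrefl//]; exists (enum_val i).
exists (extend P), X; split; last split.
- split; last by rewrite -P1; exact: infinite_sum_extend.
  by move=> v; rewrite /extend; case: insubP => // _; exact: Rle_refl.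
- move=> x y; split.
    (* By [ZJ], any outcome with the given pair of values yields the right value at the join; 0 is a
       default for pairs that do not occur. *)
    exists (fun i j => if [pick w | (rk x w == i) && (rk y w == j)] is Some w
                       then rk (x `|` y)%O w else 0%N) => v /(Xval x)[w _ E].
    rewrite !E; case: pickP => [w' |/(_ w)]; last by rewrite !eqxx.
    by rewrite !rk_eq => H; apply/esym/eqP; rewrite rk_eq ZJ.
  exists (fun i => if [pick w | rk (x `|` y)%O w == i] is Some w
                   then (rk x w, rk y w) else (0%N, 0%N)) => v /(Xval x)[w _ E].
  rewrite !E; case: pickP => [w' |/(_ w)]; last by rewrite !eqxx.
  by rewrite rk_eq ZJ -!rk_eq => /andP[/eqP-> /eqP->].
move=> x; pose q v := \big[Rplus/0]_(w | rk x w == v) P w.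
exists q; split.
  move=> v; rewrite /law /q big_mkcond.
  apply: infinite_sum_ext (infinite_sum_extend _) => u.
  rewrite /extend /X; case: insubP => [i _ _|_]; last by case: Nat.eqb.
  case: eqP => [->|ne]; first by rewrite Nat.eqb_refl.
  by case: (Nat.eqb_spec _ v).
have -> : \big[Rplus/0]_w (P w * - ln (\big[Rplus/0]_(w' | Z x w' == Z x w) P w')) =
    \big[Rplus/0]_(v < #|T|) - (q v * ln (q v)).
  rewrite (partition_big (fun w => enum_rank (Z x w)) predT) //=.
  apply: eq_bigr => v _; rewrite Ropp_mult_distr_r {1}/q [RHS]Rmult_comm big_distrr /=.
  rewrite (eq_bigl (fun w => enum_rank (Z x w) == v)) //.
  apply: eq_bigr => w /eqP wv; rewrite Rmult_comm; congr (- ln _ * _).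
  by apply: eq_bigl => w'; rewrite -rk_eq /rk wv.
apply: infinite_sum_finite => v Tv.
rewrite /q big1 ?Rmult_0_l ?Ropp_0 // => w /eqP E.
by have := ltn_ord (enum_rank (Z x w)); rewrite -/(rk x w) E ltnNge Tv.
Qed.

Definition binary_entropy e := (1 - e) * - ln (1 - e) + e * - ln e.

(* The event of probability [e] switches the cosets on; this scales all the
   entropies [ln M] by [e], up to a common additive error. *)
Lemma group_entropic (V : finZmodType) (K : L -> {set V}) (M : L -> nat) (e : R) :
  0 < e < 1 ->
  (forall x, 0%R \in K x) -> (forall x, {in K x &, forall u v, (u - v)%R \in K x}) ->
  (forall x y, K (x `|` y)%O = K x :&: K y) -> (forall x, #|K x| * M x = #|V|)%N ->
  entropic (fun x => binary_entropy e + e * ln (INR (M x))).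
Proof.
move=> e01 K0 KB KJ KM.
have Vpos : (0 < #|V|)%N by apply/card_gt0P; exists 0%R.
have V0 : 0 < INR #|V| by apply: lt_0_INR; apply/ssrnat.ltP.
pose P (o : option V) := if o is Some _ then e / INR #|V| else 1 - e.
pose Z x (o : option V) := omap (fun v => [set u | (u - v)%R \in K x]) o.
have opp x v : v \in K x -> (- v)%R \in K x.
  by move=> vK; rewrite -[(- v)%R]GRing.add0r; apply: KB.
have Z_eq x u v : (Z x (Some u) == Z x (Some v)) = ((u - v)%R \in K x).
  apply/eqP/idP => [[]/setP/(_ u)|uv]; first by rewrite !inE GRing.subrr K0 => /esym.
  congr Some; apply/setP => w; rewrite !inE; apply/idP/idP => H.
    have -> : (w - v = (w - u) - - (u - v))%R by rewrite GRing.opprK GRing.addrA GRing.subrK.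
    by apply: KB => //; exact: opp.
  have -> : (w - u = (w - v) - (u - v))%R by rewrite GRing.opprB GRing.addrA GRing.subrK.
  exact: KB.
have bigV (G : option V -> R) : \big[Rplus/0]_o G o = G None + \big[Rplus/0]_v G (Some v).
  rewrite (bigD1 None) //=; congr (_ + _).
  rewrite (reindex_omap Some (fun o => o)) /=; last by case.
  by apply: eq_bigl => v; rewrite eqxx.
have P0 o : 0 <= P o.
  by case: o => [v|]; rewrite /P; [apply: Rlt_le; apply: Rdiv_lt_0_compat; lra|lra].
have := @finite_entropic _ _ P Z P0.
have -> : \big[Rplus/0]_w P w = 1.
  rewrite bigV /P rsum_constT.
  by change (1 - e + INR #|V| * (e / INR #|V|) = 1); field; lra.
move=> /(_ erefl) H.
have ZJ x y o o' : (Z (x `|` y)%O o == Z (x `|` y)%O o') =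
    (Z x o == Z x o') && (Z y o == Z y o').
  by case: o o' => [u|] [v|] //; rewrite !Z_eq KJ inE.
have {H} [q [X [pX [fX HX]]]] := H ZJ.
exists q, X; split=> //; split=> // x; have := HX x.
suff -> : \big[Rplus/0]_w (P w * - ln (\big[Rplus/0]_(w' | Z x w' == Z x w) P w')) =
  binary_entropy e + e * ln (INR (M x)) by [].
have Kpos : (0 < #|K x|)%N by apply/card_gt0P; exists 0%R; exact: K0.
have Mpos : (0 < M x)%N by move: Vpos; rewrite -(KM x) muln_gt0 => /andP[].
have k0 : 0 < INR #|K x| by apply: lt_0_INR; apply/ssrnat.ltP.
have m0 : 0 < INR (M x) by apply: lt_0_INR; apply/ssrnat.ltP.
rewrite bigV big_mkcond bigV.
have -> : \big[Rplus/0]_v (if Z x (Some v) == Z x None then P (Some v) else 0) = 0.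
  by rewrite big1.
rewrite eqxx Rplus_0_r.
(* A coset contains [#|K x|] outcomes of probability [e / #|V|], hence has probability [e / M x]. *)
have -> : \big[Rplus/0]_v (P (Some v) * - ln (\big[Rplus/0]_(w' | Z x w' == Z x (Some v)) P w'))
    = \big[Rplus/0]_(v : V) (e / INR #|V| * - ln (e / INR (M x))).
  apply: eq_bigr => v _; congr (_ * - ln _).
  rewrite big_mkcond bigV /= Rplus_0_l -big_mkcond /=.
  rewrite (eq_bigl (fun u => u \in [set u | (u - v)%R \in K x])); last first.
    by move=> u; rewrite Z_eq inE.
  rewrite (rsum_const (I := V)).
  have -> : #|[eta [in [set u | (u - v)%R \in K x]]]| = #|K x|.
    rewrite -(card_imset (K x) (GRing.addIr v)); apply: eq_card => u; rewrite !inE.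
    apply/idP/imsetP => [uK|[k kK ->]]; last by rewrite GRing.addrK.
    by exists (u - v)%R; rewrite ?GRing.subrK.
  by rewrite -(KM x) mult_INR; field; lra.
rewrite rsum_constT /binary_entropy Rplus_assoc; congr (_ + _).
rewrite /Rdiv ln_mult ?ln_Rinv //; try lra; last exact: Rinv_0_lt_compat.
change (INR #|V| * (e * / INR #|V| * - (ln e + - ln (INR (M x)))) =
  e * - ln e + e * ln (INR (M x))).
by field; lra.
Qed.

Lemma ln_le_sub1 y : 0 < y -> ln y <= y - 1.
Proof. by move=> y0; have := exp_ineq1_le (ln y); rewrite exp_ln //; lra. Qed.

(** The inequality [ln y <= y - 1] at [/ (1 - e)] bounds the first term by [e], and at [/ sqrt e]
    the second by [2 * sqrt e]. *)
Lemma binary_entropy_bounds e : 0 < e < 1 -> 0 <= binary_entropy e <= 3 * sqrt e.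
Proof.
move=> [e0 e1]; have s0 : 0 < sqrt e by exact: sqrt_lt_R0.
have ss : sqrt e * sqrt e = e by apply: sqrt_sqrt; lra.
have s1 : sqrt e < 1 by nra.
have l0 : ln e <= 0 by have := ln_le_sub1 e0; lra.
have l1 : ln (1 - e) <= 0 by have := @ln_le_sub1 (1 - e); lra.
rewrite /binary_entropy; split; first by nra.
have H1 : (1 - e) * - ln (1 - e) <= e.
  have := @ln_le_sub1 (/ (1 - e)); rewrite ln_Rinv; last lra.
  have i0 : 0 < / (1 - e) by apply: Rinv_0_lt_compat; lra.
  move=> /(_ i0) H; have := Rmult_le_compat_l (1 - e) _ _ _ H.
  rewrite Rmult_minus_distr_l Rinv_r; lra.
have H2 : e * - ln e <= 2 * sqrt e.
  have i0 : 0 < / sqrt e by apply: Rinv_0_lt_compat.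
  have := ln_le_sub1 i0; rewrite ln_Rinv // => H.
  have -> : ln e = ln (sqrt e) + ln (sqrt e) by rewrite -ln_mult ?ss.
  have := Rmult_le_compat_l _ _ _ (Rlt_le _ _ s0) H.
  rewrite Rmult_minus_distr_l Rinv_r; last lra.
  move: ss s0; move: (sqrt e) (ln (sqrt e)) => s k <- s0 H'.
  by have := Rmult_le_compat_l _ _ _ (Rlt_le _ _ s0) H'; nra.
nra.
Qed.

End FiniteModels.

Section Approximation.

Variables (d : Order.disp_t) (L : finLatticeType d).

Local Open Scope R_scope.

Lemma frame_closure (eye : pred L) (l r base : L -> L) (h : L -> R) :
  frame eye l r base -> polymatroid h -> in_closure (@entropic d L) h.
Proof.
move=> F hpoly eps eps0.
have [x0 _|noL] := pickP (@predT L); last first.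
  exists h; split; last by move=> x; have := noL x.
  pose P (o : unit) := 1.
  have [|||q [X [pX [fX HX]]]] := @finite_entropic d L unit unit P (fun _ => id).
  - by move=> w; rewrite /P; lra.
  - by rewrite (big_pred1 tt) //; case.
  - by move=> x; have := noL x.
  by exists q, X; split=> //; split=> // x; have := noL x.
have [tp tpP] := top_exists x0; have [bt btP] := bot_exists x0.
have [p Lp p_pr] := prime_above #|L|.
have p1 : 1 < INR p by apply: lt_1_INR; apply/ssrnat.ltP; exact: prime_gt1.
have lp : 0 < ln (INR p) by rewrite -ln_1; apply: ln_increasing; lra.
pose C := 2 * INR (slack L) + 1.
have C0 : 0 < C by have := pos_INR (slack L); rewrite /C; lra.
(* The three terms ensure in turn [e < 1], a rounding error below [eps / 2], and [sqrt e < eps / 6],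
   which keeps the binary entropy below [eps / 2]. *)
pose B := 2 / ln (INR p) + 2 * C / eps + 36 / (eps * eps) / ln (INR p).
have b1 : 0 < 2 / ln (INR p) by apply: Rdiv_lt_0_compat; lra.
have b2 : 0 < 2 * C / eps by apply: Rdiv_lt_0_compat; lra.
have ee : 0 < eps * eps by nra.
have b3 : 0 < 36 / (eps * eps) / ln (INR p).
  by apply: Rdiv_lt_0_compat => //; apply: Rdiv_lt_0_compat; lra.
have [n nB] : exists n, B < INR n.
  by exists (rfloor B).+1; rewrite S_INR; apply: (proj2 (rfloorP _)); rewrite /B; lra.
have n0 : 0 < INR n by rewrite /B in nB; lra.
have nl : 0 < INR n * ln (INR p) by nra.
(* With this [e], a variable uniform on [p ^ k] values contributes exactly [k / n]. *)
pose e := / (INR n * ln (INR p)).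
have e0 : 0 < e by exact: Rinv_0_lt_compat.
have e1 : e < 1.
  rewrite /e -Rinv_1; apply: Rinv_lt_contravar; first lra.
  have H : 2 / ln (INR p) < INR n by rewrite /B in nB; lra.
  have := Rmult_lt_compat_r _ _ _ lp H; rewrite /Rdiv Rmult_assoc Rinv_l; lra.
have He : binary_entropy e < eps / 2.
  have [_ H] := binary_entropy_bounds (conj e0 e1).
  suff : sqrt e < eps / 6 by lra.
  rewrite -(sqrt_square (eps / 6)); last lra.
  apply: sqrt_lt_1; [lra|nra|].
  rewrite -[X in _ < X]Rinv_inv; apply: Rinv_lt_contravar.
    by apply: Rmult_lt_0_compat => //; apply: Rinv_0_lt_compat; nra.
  have -> : / (eps / 6 * (eps / 6)) = 36 / (eps * eps) by field; lra.
  have H' : 36 / (eps * eps) / ln (INR p) < INR n by rewrite /B in nB; lra.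
  have := Rmult_lt_compat_r _ _ _ lp H'; rewrite {1}/Rdiv Rmult_assoc Rinv_l; lra.
have Hn : C / INR n < eps / 2.
  have H' : 2 * C / eps < INR n by rewrite /B in nB; lra.
  have := Rmult_lt_compat_r _ _ _ eps0 H'; rewrite {1}/Rdiv Rmult_assoc Rinv_l; last lra.
  move=> H; apply: (Rmult_lt_reg_r (INR n)) => //.
  rewrite /Rdiv Rmult_assoc Rinv_l; lra.
pose tg := target eye l r base h bt n.
exists (fun x => binary_entropy e + e * ln (INR (p ^ tg x)%N)); split.
  apply: (@group_entropic _ _ _ (kernel eye l r base h bt n p)) => //.
  - exact: (kernel0 F).
  - exact: (kernelB (p := p)).
  - exact: (kernel_join F).
  - exact: (card_kernel F).
move=> x.
have -> : e * ln (INR (p ^ tg x)%N) = INR (tg x) / INR n.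
  have -> : INR (p ^ tg x)%N = (INR p) ^ tg x.
    by elim: (tg x) => //= k IH; rewrite expnS mult_INR IH.
  rewrite -Rpower_pow; last lra.
  by rewrite /Rpower ln_exp /e; field; lra.
have H := target_bound F hpoly tpP btP n x; rewrite -/C -/tg in H.
have [h0 _] := binary_entropy_bounds (conj e0 e1).
have H' : Rabs (h x - INR (tg x) / INR n) <= C / INR n.
  have -> : h x - INR (tg x) / INR n = - ((INR (tg x) - INR n * h x) / INR n) by field; lra.
  rewrite Rabs_Ropp /Rdiv Rabs_mult Rabs_inv (Rabs_pos_eq (INR n)); last lra.
  by apply: Rmult_le_compat_r => //; apply: Rlt_le; exact: Rinv_0_lt_compat.
have -> : h x - (binary_entropy e + INR (tg x) / INR n) =
    (h x - INR (tg x) / INR n) + - binary_entropy e by ring.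
apply: Rle_lt_trans (Rabs_triang _ _) _; rewrite Rabs_Ropp (Rabs_pos_eq (binary_entropy e)); lra.
Qed.

End Approximation.

(** * Entropic functions are polymatroids *)

Section SeriesTheory.

Local Open Scope R_scope.

Implicit Types (s : nat -> R) (l : R).

Lemma infinite_sum_cv s l : infinite_sum s l <-> Un_cv (fun n => \big[Rplus/0]_(w < n.+1) s w) l.
Proof.
by split=> H eps /H[N HN]; exists N => n /HN; rewrite sum_f_R0_big.
Qed.

Lemma Un_cv_const c : Un_cv (fun=> c) c.
Proof. by move=> eps e0; exists 0%N => n _; rewrite Rdist_eq. Qed.

Lemma infinite_sum_le s s' l l' : (forall w, s w <= s' w) ->
  infinite_sum s l -> infinite_sum s' l' -> l <= l'.
Proof.
move=> le /infinite_sum_cv cv /infinite_sum_cv; apply: Rle_cv_lim cv => n.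
exact: rsum_le.
Qed.

Lemma infinite_sum0 : infinite_sum (fun=> 0) 0.
Proof.
by move=> eps e0; exists 0%N => n _; rewrite sum_f_R0_big big1 // Rdist_eq.
Qed.

Lemma infinite_sum_ge0 s l : (forall w, 0 <= s w) -> infinite_sum s l -> 0 <= l.
Proof. by move=> s0; apply: infinite_sum_le infinite_sum0. Qed.

Lemma infinite_sumD s s' l l' : infinite_sum s l -> infinite_sum s' l' ->
  infinite_sum (fun w => s w + s' w) (l + l').
Proof.
move=> /infinite_sum_cv H /infinite_sum_cv H' eps e0.
have [N HN] := CV_plus _ _ _ _ H H' eps e0; exists N => n /HN.
by rewrite sum_f_R0_big big_split.
Qed.

Lemma infinite_sumZ c s l : infinite_sum s l -> infinite_sum (fun w => c * s w) (c * l).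
Proof.
move=> /infinite_sum_cv H eps e0.
have [N HN] := CV_mult _ _ _ _ (Un_cv_const c) H eps e0; exists N => n /HN.
by rewrite sum_f_R0_big big_distrr.
Qed.

Lemma infinite_sum_big (I : finType) (P : pred I) (s : I -> nat -> R) (l : I -> R) :
  (forall i, infinite_sum (s i) (l i)) ->
  infinite_sum (fun w => \big[Rplus/0]_(i | P i) s i w) (\big[Rplus/0]_(i | P i) l i).
Proof.
move=> H; elim: (index_enum I) => [|i r IH].
  by rewrite big_nil; apply: infinite_sum_ext infinite_sum0 => w; rewrite big_nil.
rewrite big_cons; case: ifP => Pi.
  apply: infinite_sum_ext (infinite_sumD (H i) IH) => w.
  by rewrite big_cons Pi.
by apply: infinite_sum_ext IH => w; rewrite big_cons Pi.
Qed.

Lemma infinite_sum_partial s l N : (forall w, 0 <= s w) -> infinite_sum s l ->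
  \big[Rplus/0]_(w < N) s w <= l.
Proof.
move=> s0 H; case: N => [|N]; first by rewrite big_ord0; exact: infinite_sum_ge0 H.
apply: (growing_ineq (fun n => \big[Rplus/0]_(w < n.+1) s w)); last exact/infinite_sum_cv.
by move=> n; rewrite [X in _ <= X]big_ord_recr /=; have := s0 n.+1; lra.
Qed.

Lemma infinite_sum_bounded s l : (forall w, 0 <= s w) ->
  (forall N, \big[Rplus/0]_(w < N) s w <= l) -> exists2 l', infinite_sum s l' & l' <= l.
Proof.
move=> s0 sl; pose U n := \big[Rplus/0]_(w < n.+1) s w.
have Ug : Un_growing U.
  by move=> n; rewrite /U [X in _ <= X]big_ord_recr /=; have := s0 n.+1; lra.
have [|l' cv] := growing_cv U Ug; first by exists l => _ [n ->]; exact: sl.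
exists l'; first exact/infinite_sum_cv.
by apply: Rle_cv_lim cv (Un_cv_const l) => n; exact: sl.
Qed.

End SeriesTheory.

(** * Shannon inequalities for countable laws *)

Section EntropyInequalities.

Local Open Scope R_scope.

Variable p : nat -> R.
Hypothesis pdist : prob_dist p.
Implicit Types (X Y M J : nat -> nat) (q : nat -> R).

Local Notation is_law X q := (forall v, law p X v (q v)).

Lemma prob_ge0 w : 0 <= p w. Proof. by case: pdist. Qed.

Definition at_value X v w := if Nat.eqb (X w) v then p w else 0.

Lemma at_value_ge0 X v w : 0 <= at_value X v w.
Proof. by rewrite /at_value; case: ifP => _; [exact: prob_ge0|exact: Rle_refl]. Qed.

Lemma law_ge0 X q v : is_law X q -> 0 <= q v.
Proof. by move=> /(_ v); apply: infinite_sum_ge0; exact: at_value_ge0. Qed.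

Lemma law_le1 X q v : is_law X q -> q v <= 1.
Proof.
move=> /(_ v) H; apply: infinite_sum_le H (proj2 pdist) => w.
by case: ifP => _; [exact: Rle_refl|exact: prob_ge0].
Qed.

Lemma law_ge X q w : is_law X q -> p w <= q (X w).
Proof.
move=> lX; have := infinite_sum_partial w.+1 (at_value_ge0 X (X w)) (lX (X w)).
rewrite big_ord_recr /= {2}/at_value Nat.eqb_refl.
apply: Rle_trans; rewrite -[X in X <= _]Rplus_0_l; apply: Rplus_le_compat_r.
by apply: rsum_ge0 => i _; exact: at_value_ge0.
Qed.

Lemma neg_ln_ge0 r : 0 <= r <= 1 -> 0 <= - ln r.
Proof.
move=> [[r0|<-] r1]; first by have := ln_le_sub1 r0; lra.
(* At [r = 0] the convention that [ln] is 0 there is used. *)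
by rewrite /ln; case: Rlt_dec => [/Rlt_irrefl//|_]; lra.
Qed.

Lemma ln_mono a b : 0 < a -> a <= b -> ln a <= ln b.
Proof. by move=> a0 [ab|->]; [apply/Rlt_le/ln_increasing|exact: Rle_refl]. Qed.

Lemma sum_at_value X (P : pred nat) B w :
  \big[Rplus/0]_(v < B | P v) at_value X v w = if (X w < B)%N && P (X w) then p w else 0.
Proof.
case: ifP => [/andP[lt PX]|nP].
  rewrite (bigD1 (Ordinal lt)) //= {1}/at_value Nat.eqb_refl big1 ?Rplus_0_r // => v.
  rewrite /at_value; case: Nat.eqb_spec => // E /andP[_ /eqP[]].
  by apply: val_inj.
apply: big1 => v Pv; rewrite /at_value; case: Nat.eqb_spec => // E.
by move: nP; rewrite E Pv ltn_ord.
Qed.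

Lemma law_sum_le X q (P : pred nat) B : is_law X q ->
  infinite_sum (fun w => if (X w < B)%N && P (X w) then p w else 0)
    (\big[Rplus/0]_(v < B | P v) q v).
Proof.
move=> lX; have H := infinite_sum_big (fun v : 'I_B => P v) (fun v : 'I_B => lX v).
by apply: infinite_sum_ext H => w; rewrite -sum_at_value.
Qed.

Lemma bounded_values X N : exists B, forall w, (w < N)%N -> (X w < B)%N.
Proof.
by exists (\max_(w < N) X w).+1 => w wN; rewrite ltnS (leq_bigmax (Ordinal wN)).
Qed.

(** A double series with nonnegative terms is summed over outcomes instead of values. Both
    inequalities come from truncation: finitely many outcomes take finitely many values, and
    finitely many values give a subseries of the outcomes. *)
Lemma entropy_pointwise X q H : is_law X q ->
  infinite_sum (fun v => - (q v * ln (q v))) H ->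
  infinite_sum (fun w => p w * - ln (q (X w))) H.
Proof.
move=> lX HX.
have g0 v : 0 <= - ln (q v) by apply: neg_ln_ge0; split; [exact: law_ge0|exact: law_le1].
have t0 w : 0 <= p w * - ln (q (X w)) by apply: Rmult_le_pos; [exact: prob_ge0|].
have E v : - (q v * ln (q v)) = - ln (q v) * q v by ring.
have v0 v : 0 <= - (q v * ln (q v)).
  by rewrite E; apply: Rmult_le_pos => //; exact: law_ge0.
have S (B : nat) w : \big[Rplus/0]_(v < B) (- ln (q v) * at_value X v w) =
    if (X w < B)%N then p w * - ln (q (X w)) else 0.
  case: ifP => [lt|nlt].
    rewrite (bigD1 (Ordinal lt)) //= {1}/at_value Nat.eqb_refl big1 => [|v]; first by ring.
    rewrite /at_value; case: Nat.eqb_spec => [E'|_ _]; last by ring.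
    by case/eqP; apply: val_inj.
  apply: big1 => v _; rewrite /at_value; case: Nat.eqb_spec => [E'|_]; last by ring.
  by move: nlt; rewrite E' ltn_ord.
have up N : \big[Rplus/0]_(w < N) (p w * - ln (q (X w))) <= H.
  have [B HB] := bounded_values X N.
  apply: Rle_trans (infinite_sum_partial B v0 HX).
  rewrite (eq_bigr (fun w : 'I_N => \big[Rplus/0]_(v < B) (- ln (q v) * at_value X v w))).
    rewrite exchange_big /=; apply: rsum_le => v _; rewrite E -big_distrr /=.
    apply: Rmult_le_compat_l => //.
    exact: infinite_sum_partial (at_value_ge0 X v) (lX v).
  by move=> w _; rewrite S HB.
have [l Hl lH] := infinite_sum_bounded t0 up.
suff Hle : H <= l by have -> : H = l by lra.
move/infinite_sum_cv: HX => cv; apply: Rle_cv_lim cv (Un_cv_const l) => B.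
have HB : infinite_sum (fun w => \big[Rplus/0]_(v < B.+1) (- ln (q v) * at_value X v w))
    (\big[Rplus/0]_(v < B.+1) (- ln (q v) * q v)).
  by apply: (@infinite_sum_big _ xpredT) => v; apply: infinite_sumZ; exact: lX.
rewrite (eq_bigr (fun v : 'I_B.+1 => - ln (q v) * q v)); last by move=> v _; rewrite E.
by apply: infinite_sum_le HB Hl => w; rewrite S; case: ifP => _ //; exact: Rle_refl.
Qed.

Lemma entropy_ge0 X H : has_entropy p X H -> 0 <= H.
Proof.
move=> [q [lX HX]]; apply: infinite_sum_ge0 HX => v.
have := law_ge0 v lX; have := @neg_ln_ge0 (q v).
have := law_le1 v lX => a b c; have := b (conj c a); nra.
Qed.

(** Up to outcomes of probability zero, the event that [Y] equals [Y w] is contained in the event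
    that [X] equals [X w], so the pointwise terms compare. *)
Lemma entropy_mono X Y HX HY (f : nat -> nat) : (forall w, 0 < p w -> X w = f (Y w)) ->
  has_entropy p X HX -> has_entropy p Y HY -> HX <= HY.
Proof.
move=> XY [q [lX eX]] [q' [lY eY]].
apply: infinite_sum_le (entropy_pointwise lX eX) (entropy_pointwise lY eY) => w.
have [p0|<-] := prob_ge0 w; last by rewrite !Rmult_0_l; exact: Rle_refl.
apply: Rmult_le_compat_l; first lra.
apply/Ropp_le_contravar/ln_mono; first by have := law_ge w lY; lra.
apply: infinite_sum_le (lY (Y w)) (lX (X w)) => u.
have [u0|<-] := prob_ge0 u; last by do 2!case: ifP => _; exact: Rle_refl.
case: Nat.eqb_spec => [E|_]; last exact: at_value_ge0.
by rewrite (XY _ u0) (XY _ p0) E Nat.eqb_refl; exact: Rle_refl.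
Qed.

(* Conditional mutual information is nonnegative: by [ln t <= t - 1] it is enough
   that the ratios [qX qY / (qJ qM)] have expectation at most 1, which is obtained by
   grouping the outcomes according to the values of [X] and [Y]. *)
Section Submodular.

Variables (X Y J M : nat -> nat) (qX qY qJ qM : nat -> R).
Hypotheses (lX : is_law X qX) (lY : is_law Y qY) (lJ : is_law J qJ) (lM : is_law M qM).
Variables (fX fY : nat -> nat) (fJ : nat -> nat -> nat).
Hypothesis MX : forall w, 0 < p w -> M w = fX (X w).
Hypothesis MY : forall w, 0 < p w -> M w = fY (Y w).
Hypothesis JXY : forall w, 0 < p w -> J w = fJ (X w) (Y w).

Definition ratio w := qX (X w) * qY (Y w) / (qJ (J w) * qM (M w)).

Lemma ratio_sum N : \big[Rplus/0]_(w < N) (p w * ratio w) <= 1.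
Proof.
have [BX HBX] := bounded_values X N; have [BY HBY] := bounded_values Y N.
have [B HB] := bounded_values M N.
(* [a fX qX x m] is the probability that [X = x] and [M = m]; [bound x y] is a truncation of the
   joint law that would make [X] and [Y] independent given [M]. *)
pose a (f : nat -> nat) (q : nat -> R) x m := if f x == m then q x else 0.
pose bound x y := \big[Rplus/0]_(m < B) (/ qM m * (a fX qX x m * a fY qY y m)).
have inv0 r : 0 <= r -> 0 <= / r.
  by case=> [/Rinv_0_lt_compat/Rlt_le//|<-]; rewrite Rinv_0; exact: Rle_refl.
have qX0 x : 0 <= qX x by exact: law_ge0 lX.
have qY0 x : 0 <= qY x by exact: law_ge0 lY.
have qM0 x : 0 <= qM x by exact: law_ge0 lM.
have a0 f q x m : (forall v, 0 <= q v) -> 0 <= a f q x m.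
  by move=> q0; rewrite /a; case: ifP => _; [exact: q0|exact: Rle_refl].
have b0 x y m : 0 <= / qM m * (a fX qX x m * a fY qY y m).
  by apply: Rmult_le_pos; [exact: inv0|apply: Rmult_le_pos; exact: a0].
(* Outcomes of positive probability with [X = x] and [Y = y] share their values of [J] and [M]. The
   ratio is therefore constant on them, and their total probability is at most [qJ] of that value,
   which cancels the denominator. *)
have inner (x : 'I_BX) (y : 'I_BY) :
    \big[Rplus/0]_(w < N | (X w == x) && (Y w == y)) (p w * ratio w) <= bound x y.
  have [/existsP[w0 /and3P[/eqP Xw /eqP Yw w0pos]]|none] :=
      boolP [exists w : 'I_N, [&& X w == x, Y w == y & is_left (Rlt_dec 0 (p w))]]; last first.
    rewrite big1 => [|w /andP[Xw Yw]]; first by apply: rsum_ge0 => m _; exact: b0.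
    move/existsPn: none => /(_ w); rewrite Xw Yw /=; case: Rlt_dec => // np _.
    have -> : p w = 0 by have := prob_ge0 w; lra.
    by rewrite Rmult_0_l.
  have {w0pos} w0pos : 0 < p w0 by move: w0pos; case: Rlt_dec.
  have qJ0 : 0 < qJ (J w0) by have := law_ge w0 lJ; lra.
  have qMw : 0 < qM (M w0) by have := law_ge w0 lM; lra.
  apply: Rle_trans (_ : qX x * qY y / qM (M w0) <= _); last first.
    rewrite /bound (bigD1 (Ordinal (HB _ (ltn_ord w0)))) //=.
    have fx : fX x = M w0 by rewrite -Xw -MX.
    have fy : fY y = M w0 by rewrite -Yw -MY.
    rewrite -[X in X <= _]Rplus_0_r; apply: Rplus_le_compat.
      by rewrite /a fx fy eqxx; apply: Req_le; field; lra.
    by apply: rsum_ge0 => m _; exact: b0.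
  pose c := qX x * qY y / (qJ (J w0) * qM (M w0)).
  have c0 : 0 <= c.
    apply: Rmult_le_pos; first exact: Rmult_le_pos.
    by apply/Rlt_le/Rinv_0_lt_compat/Rmult_lt_0_compat.
  have -> : qX x * qY y / qM (M w0) = qJ (J w0) * c by rewrite /c; field; lra.
  apply: Rle_trans (_ : \big[Rplus/0]_(w < N) (at_value J (J w0) w * c) <= _).
    rewrite big_mkcond; apply: rsum_le => w _.
    case: ifP => [/andP[/eqP Xx /eqP Yy]|_]; last first.
      by apply: Rmult_le_pos => //; exact: at_value_ge0.
    have [pw|<-] := prob_ge0 w; last first.
      by rewrite Rmult_0_l; apply: Rmult_le_pos => //; exact: at_value_ge0.
    have Jw : J w = J w0 by rewrite !JXY // Xx Yy Xw Yw.
    have Mw : M w = M w0 by rewrite !MX // Xx Xw.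
    rewrite /at_value Jw Nat.eqb_refl /ratio Jw Mw Xx Yy; exact: Rle_refl.
  rewrite -big_distrl /=; apply: Rmult_le_compat_r => //.
  exact: infinite_sum_partial (at_value_ge0 J (J w0)) (lJ (J w0)).
have asum f q Z D m : is_law Z q -> (forall w, 0 < p w -> M w = f (Z w)) ->
    0 <= \big[Rplus/0]_(x < D) a f q x m <= qM m.
  move=> lZ MZ; split; first by apply: rsum_ge0 => x _; exact: (a0 f q x m (fun v => law_ge0 v lZ)).
  rewrite -big_mkcond /=.
  apply: infinite_sum_le (law_sum_le (fun x => f x == m) D lZ) (lM m) => w.
  have [pw|<-] := prob_ge0 w; last by do 2!case: ifP => _; exact: Rle_refl.
  rewrite (MZ _ pw); case: ifP => [/andP[_ /eqP->]|_]; last first.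
    by case: Nat.eqb; [exact: Rlt_le|exact: Rle_refl].
  by rewrite Nat.eqb_refl; exact: Rle_refl.
rewrite (partition_big (fun w : 'I_N => Ordinal (HBX _ (ltn_ord w))) xpredT) //=.
apply: Rle_trans (_ : \big[Rplus/0]_(x < BX) \big[Rplus/0]_(y < BY) bound x y <= _).
  apply: rsum_le => x _.
  rewrite (partition_big (fun w : 'I_N => Ordinal (HBY _ (ltn_ord w))) xpredT) //=.
  by apply: rsum_le => y _; exact: inner.
rewrite (eq_bigr (fun x : 'I_BX => \big[Rplus/0]_(m < B) \big[Rplus/0]_(y < BY)
    (/ qM m * (a fX qX x m * a fY qY y m)))); last by move=> x _; rewrite exchange_big.
rewrite exchange_big /=.
apply: Rle_trans (_ : \big[Rplus/0]_(m < B | xpredT m) qM m <= _); last first.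
  apply: infinite_sum_le (law_sum_le xpredT B lM) (proj2 pdist) => w.
  by case: ifP => _; [exact: Rle_refl|exact: prob_ge0].
apply: rsum_le => m _.
have -> : \big[Rplus/0]_(x < BX) \big[Rplus/0]_(y < BY) (/ qM m * (a fX qX x m * a fY qY y m)) =
    / qM m * ((\big[Rplus/0]_(x < BX) a fX qX x m) * (\big[Rplus/0]_(y < BY) a fY qY y m)).
  rewrite big_distrl big_distrr /=; apply: eq_bigr => x _.
  by rewrite big_distrr big_distrr.
have [A0 A1] := asum fX qX X BX m lX MX; have [C0 C1] := asum fY qY Y BY m lY MY.
move: (\big[Rplus/0]_(x < BX) _) (\big[Rplus/0]_(y < BY) _) A0 A1 C0 C1 => A C A0 A1 C0 C1.
(* If [qM m = 0], the marginal sum [A] vanishes as well; otherwise both sums are at most [qM m]. *)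
have [qm|qm] := qM0 m; last first.
  have -> : A = 0 by lra.
  by rewrite Rmult_0_l Rmult_0_r; exact: qM0.
have AC : A * C <= qM m * qM m by apply: Rmult_le_compat.
have := Rmult_le_compat_l _ _ _ (inv0 _ (qM0 m)) AC.
have -> : / qM m * (qM m * qM m) = qM m by field; lra.
exact.
Qed.

(** Partial sums are compared after adding the total mass 1 to both sides: on the left it appears as
    the series of [p], on the right it dominates the partial sums of [p w * ratio w]. Convergence of
    the latter is thus never at issue. *)
Lemma entropy_submodular HX HY HJ HM :
  infinite_sum (fun v => - (qX v * ln (qX v))) HX ->
  infinite_sum (fun v => - (qY v * ln (qY v))) HY ->
  infinite_sum (fun v => - (qJ v * ln (qJ v))) HJ ->
  infinite_sum (fun v => - (qM v * ln (qM v))) HM -> HJ + HM <= HX + HY.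
Proof.
move=> /(entropy_pointwise lX) eX /(entropy_pointwise lY) eY.
move=> /(entropy_pointwise lJ) eJ /(entropy_pointwise lM) eM.
have lhs := infinite_sumD (infinite_sumD eJ eM) (proj2 pdist).
have rhs := infinite_sumD eX eY.
suff : HJ + HM + 1 <= HX + HY + 1 by lra.
move/infinite_sum_cv: lhs => lhs; move/infinite_sum_cv: rhs => rhs.
apply: Rle_cv_lim lhs (CV_plus _ _ _ _ rhs (Un_cv_const 1)) => n /=.
apply: Rle_trans (Rplus_le_compat_l _ _ _ (ratio_sum n.+1)); rewrite -big_split /=.
apply: rsum_le => w _; have [pw|<-] := prob_ge0 w; last by lra.
have [x0 y0 j0 m0] : [/\ 0 < qX (X w), 0 < qY (Y w), 0 < qJ (J w) & 0 < qM (M w)].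
  by split; [have := law_ge w lX|have := law_ge w lY|have := law_ge w lJ|have := law_ge w lM]; lra.
have r0 : 0 < ratio w.
  by apply: Rdiv_lt_0_compat; apply: Rmult_lt_0_compat.
have E : ln (ratio w) = ln (qX (X w)) + ln (qY (Y w)) - ln (qJ (J w)) - ln (qM (M w)).
  have jm := Rmult_lt_0_compat _ _ j0 m0.
  rewrite /ratio /Rdiv ln_mult ?ln_Rinv ?ln_mult //; first by ring.
    exact: Rmult_lt_0_compat.
  exact: Rinv_0_lt_compat.
have := Rmult_le_compat_l _ _ _ (Rlt_le _ _ pw) (ln_le_sub1 r0); rewrite E; lra.
Qed.

End Submodular.

End EntropyInequalities.

Section Converse.

Variables (d : Order.disp_t) (L : finLatticeType d).

Local Open Scope R_scope.

Lemma entropic_polymatroid (h : L -> R) : entropic h -> polymatroid h.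
Proof.
move=> [p [X [pd [fX HX]]]].
have down x y : (x <= y)%O -> exists f, forall w, 0 < p w -> X x w = f (X y w).
  move=> xy; have [_ [g Hg]] := fX x y; exists (fun v => (g v).1) => w pw.
  by have := Hg w pw; rewrite (join_r xy) => <-.
split; last split.
- by move=> x; exact: (entropy_ge0 pd (HX x)).
- by move=> x y /down[f Hf]; exact: (entropy_mono pd Hf (HX x) (HX y)).
move=> x y; apply: Rle_ge.
have [[f Hf] _] := fX x y.
have [gx Hgx] := down _ _ (leIl x y); have [gy Hgy] := down _ _ (leIr y x).
have [qx [lx ex]] := HX x; have [qy [ly ey]] := HX y.
have [qj [lj ej]] := HX (x `|` y)%O; have [qm [lm em]] := HX (x `&` y)%O.
exact: (entropy_submodular pd lx ly lj lm Hgx Hgy Hf ex ey ej em).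
Qed.

Lemma closure_polymatroid (h : L -> R) : in_closure (@entropic d L) h -> polymatroid h.
Proof.
move=> hcl.
have approx eps : 0 < eps -> exists2 g, polymatroid g & forall x, g x - eps < h x < g x + eps.
  move=> /hcl[g [/entropic_polymatroid gp H]]; exists g => // x.
  by have := Rabs_def2 _ _ (H x); lra.
split; last split.
- move=> x; apply: Rle_plus_epsilon => eps /approx[g [g0 _] H].
  by have := H x; have := g0 x; lra.
- move=> x y xy; apply: Rle_plus_epsilon => eps e0.
  have [|g [_ [gm _]] H] := approx (eps / 2); first lra.
  by have := H x; have := H y; have := gm _ _ xy; lra.
move=> x y; apply/Rle_ge/Rle_plus_epsilon => eps e0.
have [|g [_ [_ gs]] H] := approx (eps / 4); first lra.
have := H x; have := H y; have := H (x `|` y)%O; have := H (x `&` y)%O.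
by have := gs x y; lra.
Qed.

End Converse.

Theorem theorem17 (d : Order.disp_t) (L : finLatticeType d) :
  modular_lattice L -> planar_lattice L -> shannon_lattice L.
Proof.
move=> modL /(planar_frame modL)[eye [l [r [base F]]]] h; split.
  exact: (frame_closure F).
exact: closure_polymatroid.
Qed.
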